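(* Let $G$ be a finite simplicial graph with probability-space-vertices, let $(A^G,E^G)$ be the corresponding graph free probability space over $D^G$, and let $s\in\mathbb{N}$. Let $\{x_1,\dots,x_s\}$ and $\{y_1,\dots,y_s\}$ be subsets of $A^G$ which are $G$-free in $(A^G,E^G)$. Then $$R^G_{x_1y_1,\dots,x_sy_s}(z_1,\dots,z_s)=\big(R^G_{x_1,\dots,x_s}\ \boxed{*}_G\ R^G_{y_1,\dots,y_s}\big)(z_1,\dots,z_s)$$ in $D^G[[z_1,\dots,z_s]]$, where the right-hand side denotes the series $$\sum_{n=1}^\infty\ \sum_{(i_1,\dots,i_n)\in\{1,\dots,s\}^n}\Big(\sum_{\pi\in NC(n)}k_\pi^{(E^G)}(x_{i_1},\dots,x_{i_n})\,k_{Kr(\pi)}^{(E^G)}(y_{i_1},\dots,y_{i_n})\Big)z_{i_1}\cdots z_{i_n}.$$ In particular, for each $j\in\{1,\dots,s\}$, $$R^G_{x_jy_j}(z)=\big(R^G_{x_j}\ \boxed{*}_G\ R^G_{y_j}\big)(z)=\sum_{n=1}^\infty\Big(\sum_{\pi\in NC(n)}k_\pi^{(E^G)}(x_j,\dots,x_j)\,k_{Kr(\pi)}^{(E^G)}(y_j,\dots,y_j)\Big)z^n$$ in $D^G[[z]]$.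
   Context: A noncommutative probability space $(A,\varphi)$ is a unital complex algebra $A$ with a linear functional $\varphi:A\to\mathbb{C}$, $\varphi(1)=1$. $G$ is a finite simplicial (undirected, no loops, no multiple edges) graph with vertex set $V(G)$; to each $v\in V(G)$ is attached a noncommutative probability space $(A_v,\varphi_v)$ (a ''probability-space-vertex''). A finite path $[v_1,v_2],[v_2,v_3],\dots,[v_k,v_{k+1}]$ (successive edges of $G$) is denoted $w=[v_1,\dots,v_{k+1}]$, is identified with the reversed path $[v_{k+1},\dots,v_1]$, and has length $|w|=k=|\{v_1,\dots,v_{k+1}\}|-1$. $FP(G)$ is the set of all finite paths of length $\ge 1$, and $\mathbb{F}^+(G)=V(G)\cup FP(G)$. For $w=[v_1,\dots,v_k]\in FP(G)$ put $A_w=A_{v_1}*\cdots*A_{v_k}$ and $\varphi_w=\varphi_{v_1}*\cdots*\varphi_{v_k}$ (usual free product); for a vertex $w$, $(A_w,\varphi_w)$ is the attached space. The graph free product is $A^G=\mathbb{C}\oplus\big(\bigoplus_{w\in\mathbb{F}^+(G)}A_w\big)$ with componentwise operations (a direct sum consisting of all families $\oplus_w a_w$, with unit the family of units); $D^G=\mathbb{C}\oplus\big(\bigoplus_{w\in\mathbb{F}^+(G)}\mathbb{C}_w\big)$, $\mathbb{C}_w=\mathbb{C}$; the conditional expectation $E^G:A^G\to D^G$ is $\bigoplus_{w}\varphi_w$ (identity on the first summand $\mathbb{C}$). $(A^G,E^G)$ is the graph free probability space. $D^G$ commutes with $A^G$. The $D^G$-valued cumulants are $k_n^{(E^G)}(x_1,\dots,x_n)=\sum_{\pi\in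 NC(n)}\big(\prod_{V\in\pi}E^G(\prod_{i\in V}x_i)\big)\mu(\pi,1_n)$ (products within a block in increasing order of indices; $NC(n)$ the lattice of noncrossing partitions of $\{1,\dots,n\}$, $\mu$ its Möbius function). For $\pi\in NC(n)$, $k_\pi^{(E^G)}(x_1,\dots,x_n)=\prod_{V\in\pi}k_{|V|}^{(E^G)}\big((x_i)_{i\in V}\big)$ with arguments in increasing order. $Kr:NC(n)\to NC(n)$ is the Kreweras complementation map: $Kr(\pi)$ is the largest noncrossing partition $\sigma$ of $\{\bar1,\dots,\bar n\}$ such that $\pi\cup\sigma$ is noncrossing on $1<\bar1<2<\bar2<\cdots<n<\bar n$. Subalgebras $A_1,A_2$ of $A^G$ are $G$-free if all their mixed $D^G$-valued cumulants vanish, i.e. $k_n^{(E^G)}(a_1,\dots,a_n)=0$ whenever $n\ge2$, $a_j\in A_{i_j}$ and $(i_1,\dots,i_n)\in\{1,2\}^n$ is not constant. Subsets $X_1,X_2$ of $A^G$ are $G$-free if the subalgebras generated by $X_1\cup D^G$ and $X_2\cup D^G$ are $G$-free. The graph R-transform of $x_1,\dots,x_s\in A^G$ is $$R^G_{x_1,\dots,x_s}(z_1,\dots,z_s)=\sum_{n=1}^\infty\ \sum_{(i_1,\dots,i_n)\in\{1,\dots,s\}^n}k_n^{(E^G)}(x_{i_1},\dots,x_{i_n})\,z_{i_1}\cdots z_{i_n}\in D^G[[z_1,\dots,z_s]]$$ in noncommuting indeterminates; the symbol $\boxed{*}_G$ is merely notation for the series displayed in the claim. *)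

(* Defs.v *)
From HB Require Import structures.
From mathcomp Require Import all_boot all_order all_algebra.
From mathcomp Require Import boolp classical_sets functions.
(* Again, for the unqualified names to be those of fintype and finset. *)
From mathcomp Require Import fintype finset.

Set Implicit Arguments.
Unset Strict Implicit.
Unset Printing Implicit Defensive.

Import Order.TTheory GRing.Theory.
Local Open Scope ring_scope.
Local Open Scope quotient_scope.

(* [algType] carries [1 != 0], which [nc_exp1] forces anyway.                 *)
Record ncps (K : fieldType) := NCPS {
  nc_alg :> algType K;
  nc_exp : {scalar nc_alg};
  nc_exp1 : nc_exp 1 = 1
}.

Section ScalarSpace.
Variable K : fieldType.

Definition scalar_exp (x : K^o) : K := x.

Fact scalar_exp_is_scalar : scalar scalar_exp. Proof. by []. Qed.

HB.instance Definition _ :=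
  GRing.isLinear.Build K K^o K *%R scalar_exp scalar_exp_is_scalar.

Definition scalar_ncps : ncps K := NCPS (erefl : scalar_exp 1 = 1).

End ScalarSpace.

(* [fprod A] is the unital algebra presented by the generators [FPgen i a],   *)
(* i : I and a : A i, and the relations making each [FPgen i] a morphism of   *)
(* unital algebras: formal expressions modulo the least congruence [fpeq]     *)
(* containing the algebra axioms and these relations. That it is the free     *)
(* product of the A_i is [fprod_lift_in] and [fprod_lift_unique] below; that  *)
(* [fprod_exp] is the free product of the phi_i is [fprod_exp_in] and         *)
(* [fprod_exp_alternating].                                                   *)
Section FreeProduct.
Variables (K : fieldType) (I : eqType) (A : I -> ncps K).

Inductive fpterm : Type :=
| FPgen (i : I) of A i
| FPzero
| FPone
| FPadd of fpterm & fpterm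
| FPmul of fpterm & fpterm
| FPscale of K & fpterm.

Inductive fpeq : fpterm -> fpterm -> Prop :=
| fpeq_refl x : fpeq x x
| fpeq_sym x y : fpeq x y -> fpeq y x
| fpeq_trans x y z : fpeq x y -> fpeq y z -> fpeq x z
| fpeq_add x x' y y' : fpeq x x' -> fpeq y y' -> fpeq (FPadd x y) (FPadd x' y')
| fpeq_mul x x' y y' : fpeq x x' -> fpeq y y' -> fpeq (FPmul x y) (FPmul x' y')
| fpeq_scale c x x' : fpeq x x' -> fpeq (FPscale c x) (FPscale c x')
| fpeq_addA x y z : fpeq (FPadd x (FPadd y z)) (FPadd (FPadd x y) z)
| fpeq_addC x y : fpeq (FPadd x y) (FPadd y x)
| fpeq_add0 x : fpeq (FPadd FPzero x) x
| fpeq_addN x : fpeq (FPadd (FPscale (-1) x) x) FPzero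
| fpeq_mulA x y z : fpeq (FPmul x (FPmul y z)) (FPmul (FPmul x y) z)
| fpeq_mul1l x : fpeq (FPmul FPone x) x
| fpeq_mul1r x : fpeq (FPmul x FPone) x
| fpeq_mulDl x y z : fpeq (FPmul (FPadd x y) z) (FPadd (FPmul x z) (FPmul y z))
| fpeq_mulDr x y z : fpeq (FPmul x (FPadd y z)) (FPadd (FPmul x y) (FPmul x z))
| fpeq_scaleA a b x : fpeq (FPscale a (FPscale b x)) (FPscale (a * b) x)
| fpeq_scale1 x : fpeq (FPscale 1 x) x
| fpeq_scaleDr a x y :
    fpeq (FPscale a (FPadd x y)) (FPadd (FPscale a x) (FPscale a y))
| fpeq_scaleDl x a b :
    fpeq (FPscale (a + b) x) (FPadd (FPscale a x) (FPscale b x))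
| fpeq_scaleAl a x y : fpeq (FPscale a (FPmul x y)) (FPmul (FPscale a x) y)
| fpeq_scaleAr a x y : fpeq (FPscale a (FPmul x y)) (FPmul x (FPscale a y))
| fpeq_genD i c (a b : A i) :
    fpeq (FPgen (c *: a + b)) (FPadd (FPscale c (FPgen a)) (FPgen b))
| fpeq_genM i (a b : A i) : fpeq (FPgen (a * b)) (FPmul (FPgen a) (FPgen b))
| fpeq_gen1 i : fpeq (FPgen (1 : A i)) FPone.

(* The free product functional is the vacuum state of the action of the       *)
(* A_i on C (+) (+)_(i_1 <> i_2 <> ... ) ker phi_(i_1) (x) ker phi_(i_2) ...  *)
(* A tensor b_1 (x) ... (x) b_m is represented by the list of its factors,    *)
(* and [fpact t F] is the functional [v |-> F (t v)].                         *)
Definition fpstack := seq {i : I & A i}.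

Definition centered (i : I) (a : A i) : A i := a - nc_exp (A i) a *: 1.

Definition fpact_gen (i : I) (a : A i) (F : fpstack -> K) (s : fpstack) : K :=
  let push := nc_exp (A i) a * F s + F (Tagged A (centered a) :: s) in
  if s is existT j b :: t then
    if i =P j is ReflectT e then
      let c := ecast k (A k) e a * b in
      nc_exp (A j) c * F t + F (Tagged A (centered c) :: t)
    else push
  else push.

Fixpoint fpact (t : fpterm) (F : fpstack -> K) : fpstack -> K :=
  match t with
  | FPgen i a => fpact_gen a F
  | FPzero => fun=> 0
  | FPone => F
  | FPadd x y => fun s => fpact x F s + fpact y F s
  | FPmul x y => fpact y (fpact x F)
  | FPscale c x => fun s => c * fpact x F s
  end.

Definition vacuum (s : fpstack) : K := (nilp s)%:R.

Definition fpterm_exp (t : fpterm) : K := fpact t vacuum [::].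

Definition multilin (F : fpstack -> K) := forall s1 s2 i c (a b : A i),
  F (s1 ++ Tagged A (c *: a + b) :: s2) =
  c * F (s1 ++ Tagged A a :: s2) + F (s1 ++ Tagged A b :: s2).

Lemma centered_linear i c (a b : A i) :
  centered (c *: a + b) = c *: centered a + centered b.
Proof.
rewrite /centered linearP scalerDl -scalerA scalerBr.
by rewrite opprD addrACA.
Qed.

Lemma multilin_hd F s i c (a b : A i) : multilin F ->
  F (Tagged A (c *: a + b) :: s) =
  c * F (Tagged A a :: s) + F (Tagged A b :: s).
Proof. by move=> /(_ [::] s i c a b). Qed.

Lemma multilin_tl F j (d : A j) : multilin F ->
  multilin (fun s => F (Tagged A d :: s)).
Proof. by move=> mF s1 s2; apply: (mF (_ :: s1)). Qed.

Lemma fpact_gen_lin i c (a b : A i) F s : multilin F ->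
  fpact_gen (c *: a + b) F s = c * fpact_gen a F s + fpact_gen b F s.
Proof.
move=> mF; have push : forall s,
    nc_exp (A i) (c *: a + b) * F s +
      F (Tagged A (centered (c *: a + b)) :: s) =
    c * (nc_exp (A i) a * F s + F (Tagged A (centered a) :: s)) +
    (nc_exp (A i) b * F s + F (Tagged A (centered b) :: s)).
  move=> {}s; rewrite centered_linear multilin_hd // linearP /=.
  by rewrite mulrDl -mulrA mulrDr addrACA.
case: s => [|[j d] t]; rewrite /fpact_gen //=.
case: eqP => // e; subst j => /=.
rewrite mulrDl -scalerAl centered_linear multilin_hd // linearP /=.
by rewrite mulrDl -mulrA mulrDr addrACA.
Qed.

Lemma fpact_gen_multilin i (a : A i) F : multilin F -> multilin (fpact_gen a F).
Proof.
move=> mF s1 s2 j c d d'.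
case: s1 => [|[k b] t] /=; rewrite /fpact_gen; last first.
  case: eqP => [e|_]; last first.
    rewrite (mF (_ :: t)) (mF (_ :: _ :: t)) /=.
    by rewrite mulrDr mulrCA mulrDr addrACA.
  rewrite mF (mF (_ :: t)) /=.
  by rewrite mulrDr mulrCA mulrDr addrACA.
case: eqP => [e|_]; last first.
  rewrite (mF [::]) (mF [:: _]) /=.
  by rewrite mulrDr mulrCA mulrDr addrACA.
subst j => /=.
rewrite mulrDr -scalerAr centered_linear multilin_hd // linearP /=.
by rewrite mulrDl -mulrA mulrDr addrACA.
Qed.

Lemma fpact_multilin t F : multilin F -> multilin (fpact t F).
Proof.
elim: t F => [i a||| x IHx y IHy|x IHx y IHy|c x IHx] F mF //=.
- exact: fpact_gen_multilin.
- by move=> *; rewrite mulr0 addr0.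
- by move=> s1 s2 i c a b; rewrite (IHx F mF) (IHy F mF) mulrDr addrACA.
- exact: IHy (IHx _ mF).
- by move=> s1 s2 i d a b; rewrite (IHx F mF) mulrDr mulrCA.
Qed.

Lemma fpact_lin t c F G :
  fpact t (fun s => c * F s + G s) = (fun s => c * fpact t F s + fpact t G s).
Proof.
elim: t F G => [i a||| x IHx y IHy|x IHx y IHy|d x IHx] F G //=;
  apply/funext => s.
- rewrite /fpact_gen; case: s => [|[j b] t].
    by rewrite !mulrDr mulrCA addrACA.
  by case: eqP => e; rewrite !mulrDr mulrCA addrACA.
- by rewrite mulr0 addr0.
- by rewrite IHx IHy mulrDr addrACA.
- by rewrite IHx IHy.
- by rewrite IHx mulrDr mulrCA.
Qed.

Lemma fpact_add t F G :
  fpact t (fun s => F s + G s) = (fun s => fpact t F s + fpact t G s).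
Proof.
have := fpact_lin t 1 F G.
under eq_fun do rewrite mul1r.
by move=> ->; apply/funext => s; rewrite mul1r.
Qed.

Lemma fpact_scale t c F :
  fpact t (fun s => c * F s) = (fun s => c * fpact t F s).
Proof.
have z : fpact t (fun=> 0) = (fun=> 0).
  have := fpact_lin t (-1) F F.
  under eq_fun do rewrite mulN1r addNr.
  by move=> ->; apply/funext => s; rewrite mulN1r addNr.
have := fpact_lin t c F (fun=> 0); rewrite z.
under eq_fun do rewrite addr0.
by move=> ->; apply/funext => s; rewrite addr0.
Qed.

Definition reduced (s : fpstack) : bool :=
  all (fun p => nc_exp (A (tag p)) (tagged p) == 0) s &&
  sorted (fun p q => tag p != tag q) s.

Lemma nc_exp_centered i (a : A i) : nc_exp (A i) (centered a) = 0.
Proof. by rewrite /centered linearB scalarZ nc_exp1 mulr1 subrr. Qed.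

Lemma centered_id i (a : A i) : nc_exp (A i) a = 0 -> centered a = a.
Proof. by rewrite /centered => ->; rewrite scale0r subr0. Qed.

Lemma reduced_tl p s : reduced (p :: s) -> reduced s.
Proof.
case/andP=> /= /andP[_ a] so; apply/andP; split=> //.
exact: path_sorted so.
Qed.

Lemma fpact_reduced t F G : {in reduced, F =1 G} ->
  {in reduced, fpact t F =1 fpact t G}.
Proof.
elim: t F G => [i a||| x IHx y IHy|x IHx y IHy|d x IHx] F G FG //= s rs.
- have push q : reduced (q :: s) -> nc_exp (A i) a * F s + F (q :: s) =
    nc_exp (A i) a * G s + G (q :: s) by move=> ?; rewrite !FG.
  have cen k (b : A k) : nc_exp (A k) (centered b) == 0.
    by rewrite nc_exp_centered.
  rewrite /fpact_gen; case: s rs push => [|[j b] t] rs push.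
    by apply: push; rewrite /reduced /= cen.
  case: eqP => [e|ne].
    have rt : t \in reduced by apply: reduced_tl rs.
    rewrite (FG _ rt) FG //.
    move: rs; rewrite !unfold_in /reduced /= cen => /andP[/andP[_ ->]].
    by case: (t).
  apply: push; move: rs; rewrite unfold_in.
  rewrite /reduced /= cen => /andP[/andP[-> ->] ->].
  by rewrite /= andbT; apply/eqP.
- by rewrite (IHx F G) // (IHy F G).
- by apply: IHy => // ? ?; apply: IHx.
- by rewrite (IHx F G).
Qed.

Lemma multilin0 F s i : multilin F -> F (Tagged A (0 : A i) :: s) = 0.
Proof.
move=> mF; have := multilin_hd s 1 0 (0 : A i) mF.
rewrite scaler0 addr0 mul1r => /esym/eqP.
by rewrite addrC -subr_eq0 addrK => /eqP.
Qed.

Lemma fpact_gen1 i F : multilin F -> {in reduced, fpact_gen (1 : A i) F =1 F}.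
Proof.
move=> mF s rs.
have push : nc_exp (A i) 1 * F s + F (Tagged A (centered (1 : A i)) :: s) = F s.
  by rewrite /centered nc_exp1 scale1r subrr multilin0 // mul1r addr0.
rewrite /fpact_gen; case: s rs push => [|[j b] t] rs push //.
case: eqP => // e; subst j => /=; rewrite mul1r.
have b0 : nc_exp (A i) b = 0 by move: rs => /andP[/= /andP[/eqP]].
by rewrite centered_id // b0 mul0r add0r.
Qed.

Lemma fpact_genM i (a b : A i) F : multilin F ->
  {in reduced, fpact_gen (a * b) F =1 fpact_gen b (fpact_gen a F)}.
Proof.
move=> mF s rs.
have cD (c : A i) u : nc_exp (A i) (a * c) * F u +
    F (Tagged A (centered (a * c)) :: u) =
    nc_exp (A i) c * (nc_exp (A i) a * F u + F (Tagged A (centered a) :: u)) +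
    (nc_exp (A i) (a * centered c) * F u +
     F (Tagged A (centered (a * centered c)) :: u)).
  have -> : a * c = nc_exp (A i) c *: a + a * centered c.
    by rewrite /centered mulrBr -scalerAr mulr1 addrC subrK.
  rewrite centered_linear multilin_hd // linearP /=.
  by rewrite mulrDl -mulrA addrACA -mulrDr.
have self u c : fpact_gen a F (Tagged A (c : A i) :: u) =
    nc_exp (A i) (a * c) * F u + F (Tagged A (centered (a * c)) :: u).
  rewrite /fpact_gen /=; case: eqP => // e.
  by rewrite (eq_irrelevance e erefl).
have other c G u : ((if u is q :: _ then i != tag q else true) : bool) ->
   fpact_gen c G u = nc_exp (A i) c * G u + G (Tagged A (centered c) :: u).
  by case: u => // -[k d] u /= /eqP ne; rewrite /fpact_gen; case: eqP.
case: s rs => [|[j d] t] rs.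
  by rewrite (other (a * b)) // (other b) // self (other a) // cD.
case: (eqVneq i j) => [e|ne]; last first.
  by rewrite (other (a * b)) // (other b) // self (other a) // cD.
subst j.
have rt : (if t is q :: _ then i != tag q else true) : bool.
  by case: t rs => // q t /andP[_ /= /andP[]].
have h (c : A i) G : fpact_gen c G (existT _ i d :: t) =
    nc_exp (A i) (c * d) * G t + G (Tagged A (centered (c * d)) :: t).
  by rewrite /fpact_gen; case: eqP => // e; rewrite (eq_irrelevance e erefl).
rewrite !h self (other a F t) //.
by rewrite -(mulrA a b d) cD.
Qed.

Lemma fpact_eq t u : fpeq t u -> forall F, multilin F ->
  {in reduced, fpact t F =1 fpact u F}.
Proof.
elim=> {t u} /=.
- by [].
- by move=> x y _ IH F mF s rs; rewrite IH.
- by move=> x y z _ IH1 _ IH2 F mF s rs; rewrite IH1 // IH2.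
- by move=> x x' y y' _ IH1 _ IH2 F mF s rs; rewrite IH1 // IH2.
- move=> x x' y y' _ IH1 _ IH2 F mF s rs.
  rewrite IH2 //; last exact: fpact_multilin.
  by apply: fpact_reduced rs => u; apply: IH1.
- by move=> c x x' _ IH F mF s rs; rewrite IH.
- by move=> x y z F _ s _; rewrite addrA.
- by move=> x y F _ s _; rewrite addrC.
- by move=> x F _ s _; rewrite add0r.
- by move=> x F _ s _; rewrite mulN1r addNr.
- by [].
- by [].
- by [].
- by move=> x y z F _ s _; rewrite fpact_add.
- by [].
- by move=> a b x F _ s _; rewrite mulrA.
- by move=> x F _ s _; rewrite mul1r.
- by move=> a x y F _ s _; rewrite mulrDr.
- by move=> x a b F _ s _; rewrite mulrDl.
- by move=> a x y F _ s _; rewrite fpact_scale.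
- by [].
- by move=> i c a b F mF s _; rewrite fpact_gen_lin.
- by move=> i a b F mF s rs; rewrite fpact_genM.
- by move=> i F mF s rs; rewrite fpact_gen1.
Qed.

Lemma vacuum_multilin : multilin vacuum.
Proof.
by move=> s1 s2 *; rewrite /vacuum /nilp !size_cat !addnS mulr0 addr0.
Qed.

Lemma fpterm_exp_eq t u : fpeq t u -> fpterm_exp t = fpterm_exp u.
Proof. by move=> /fpact_eq; apply; [exact: vacuum_multilin|]. Qed.

Definition fpeqb (x y : {classic fpterm}) : bool := `[< fpeq x y >].

Lemma fpeqb_equiv : equiv_class_of fpeqb.
Proof.
split=> [x|x y|y x z].
- exact/asboolP/fpeq_refl.
- by apply/asboolP/asboolP => /fpeq_sym.
- by move=> /asboolP xy /asboolP yz; apply/asboolP; apply: fpeq_trans xy yz.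
Qed.

Canonical fpeqb_equiv_rel := EquivRelPack fpeqb_equiv.

Definition fprod := {eq_quot fpeqb}.

HB.instance Definition _ := Choice.on fprod.

Definition fpi (t : fpterm) : fprod := \pi t.

Lemma fpiP t u : fpi t = fpi u <-> fpeq t u.
Proof.
split=> [|tu]; first by move/eqquotP => /asboolP.
by apply/eqquotP/asboolP.
Qed.

Definition fprepr (x : fprod) : fpterm := repr x.

Lemma fpreprK x : fpi (fprepr x) = x. Proof. exact: reprK. Qed.

Lemma fpreprE t : fpeq (fprepr (fpi t)) t.
Proof. by apply/fpiP; rewrite fpreprK. Qed.

Lemma fprodW (P : fprod -> Prop) : (forall t, P (fpi t)) -> forall x, P x.
Proof. by move=> h x; rewrite -(fpreprK x). Qed.

Definition fp_add (x y : fprod) : fprod := fpi (FPadd (fprepr x) (fprepr y)).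
Definition fp_mul (x y : fprod) : fprod := fpi (FPmul (fprepr x) (fprepr y)).
Definition fp_scale c (x : fprod) : fprod := fpi (FPscale c (fprepr x)).

Lemma fp_addE t u : fp_add (fpi t) (fpi u) = fpi (FPadd t u).
Proof. by apply/fpiP/fpeq_add; apply: fpreprE. Qed.
Lemma fp_mulE t u : fp_mul (fpi t) (fpi u) = fpi (FPmul t u).
Proof. by apply/fpiP/fpeq_mul; apply: fpreprE. Qed.
Lemma fp_scaleE c t : fp_scale c (fpi t) = fpi (FPscale c t).
Proof. by apply/fpiP/fpeq_scale; apply: fpreprE. Qed.

Fact fp_addA : associative fp_add.
Proof.
by elim/fprodW=> x; elim/fprodW=> y; elim/fprodW=> z; rewrite !fp_addE;
   apply/fpiP/fpeq_addA.
Qed.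
Fact fp_addC : commutative fp_add.
Proof.
by elim/fprodW=> x; elim/fprodW=> y; rewrite !fp_addE; apply/fpiP/fpeq_addC.
Qed.
Fact fp_add0 : left_id (fpi FPzero) fp_add.
Proof. by elim/fprodW=> x; rewrite fp_addE; apply/fpiP/fpeq_add0. Qed.
Fact fp_addN : left_inverse (fpi FPzero) (fp_scale (-1)) fp_add.
Proof.
by elim/fprodW=> x; rewrite fp_scaleE fp_addE; apply/fpiP/fpeq_addN.
Qed.

HB.instance Definition _ :=
  GRing.isZmodule.Build fprod fp_addA fp_addC fp_add0 fp_addN.

Fact fp_mulA : associative fp_mul.
Proof.
by elim/fprodW=> x; elim/fprodW=> y; elim/fprodW=> z; rewrite !fp_mulE;
   apply/fpiP/fpeq_mulA.
Qed.
Fact fp_mul1l : left_id (fpi FPone) fp_mul.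
Proof. by elim/fprodW=> x; rewrite fp_mulE; apply/fpiP/fpeq_mul1l. Qed.
Fact fp_mul1r : right_id (fpi FPone) fp_mul.
Proof. by elim/fprodW=> x; rewrite fp_mulE; apply/fpiP/fpeq_mul1r. Qed.
Fact fp_mulDl : left_distributive fp_mul +%R.
Proof.
by elim/fprodW=> x; elim/fprodW=> y; elim/fprodW=> z;
   rewrite /GRing.add /= !(fp_addE, fp_mulE); apply/fpiP/fpeq_mulDl.
Qed.
Fact fp_mulDr : right_distributive fp_mul +%R.
Proof.
by elim/fprodW=> x; elim/fprodW=> y; elim/fprodW=> z;
   rewrite /GRing.add /= !(fp_addE, fp_mulE); apply/fpiP/fpeq_mulDr.
Qed.
Fact fp_oner_neq0 : fpi FPone != 0.
Proof.
apply/eqP=> /fpiP/fpterm_exp_eq/eqP.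
by rewrite /fpterm_exp /= /vacuum oner_eq0.
Qed.

HB.instance Definition _ := GRing.Zmodule_isNzRing.Build fprod
  fp_mulA fp_mul1l fp_mul1r fp_mulDl fp_mulDr fp_oner_neq0.

Fact fp_scaleA a b (x : fprod) : fp_scale a (fp_scale b x) = fp_scale (a * b) x.
Proof.
by elim/fprodW: x => x; rewrite !fp_scaleE; apply/fpiP/fpeq_scaleA.
Qed.
Fact fp_scale1 : left_id 1 fp_scale.
Proof. by elim/fprodW=> x; rewrite fp_scaleE; apply/fpiP/fpeq_scale1. Qed.
Fact fp_scaleDr : right_distributive fp_scale +%R.
Proof.
by move=> a; elim/fprodW=> x; elim/fprodW=> y;
   rewrite /GRing.add /= !(fp_addE, fp_scaleE); apply/fpiP/fpeq_scaleDr.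
Qed.
Fact fp_scaleDl (x : fprod) : {morph fp_scale^~ x : a b / a + b}.
Proof.
by elim/fprodW: x => x a b; rewrite {2}/GRing.add /= !(fp_addE, fp_scaleE);
   apply/fpiP/fpeq_scaleDl.
Qed.

HB.instance Definition _ := GRing.Zmodule_isLmodule.Build K fprod
  fp_scaleA fp_scale1 fp_scaleDr fp_scaleDl.

Fact fp_scaleAl (a : K) (x y : fprod) : a *: (x * y) = a *: x * y.
Proof.
by elim/fprodW: x => x; elim/fprodW: y => y; rewrite /GRing.mul /GRing.scale /=
   !(fp_mulE, fp_scaleE); apply/fpiP/fpeq_scaleAl.
Qed.
HB.instance Definition _ := GRing.Lmodule_isLalgebra.Build K fprod fp_scaleAl.

Fact fp_scaleAr (a : K) (x y : fprod) : a *: (x * y) = x * (a *: y).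
Proof.
by elim/fprodW: x => x; elim/fprodW: y => y; rewrite /GRing.mul /GRing.scale /=
   !(fp_mulE, fp_scaleE); apply/fpiP/fpeq_scaleAr.
Qed.
HB.instance Definition _ := GRing.Lalgebra_isAlgebra.Build K fprod fp_scaleAr.

Definition fprod_exp (x : fprod) : K := fpterm_exp (fprepr x).

Lemma fprod_expE t : fprod_exp (fpi t) = fpterm_exp t.
Proof. exact/fpterm_exp_eq/fpreprE. Qed.

Fact fprod_exp_is_scalar : scalar fprod_exp.
Proof.
move=> c; elim/fprodW=> x; elim/fprodW=> y.
rewrite /GRing.add /GRing.scale /= fp_scaleE fp_addE.
by rewrite !fprod_expE.
Qed.

HB.instance Definition _ :=
  GRing.isLinear.Build K fprod K *%R fprod_exp fprod_exp_is_scalar.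

Fact fprod_exp1 : fprod_exp 1 = 1.
Proof. by rewrite fprod_expE. Qed.

Definition free_product : ncps K := NCPS fprod_exp1.

Definition fprod_in (i : I) (a : A i) : fprod := fpi (FPgen a).

Fact fprod_in_is_linear i : linear (@fprod_in i).
Proof.
move=> c a b; rewrite /GRing.add /GRing.scale /= fp_scaleE fp_addE.
exact/fpiP/fpeq_genD.
Qed.

HB.instance Definition _ i :=
  GRing.isLinear.Build K (A i) fprod *:%R (@fprod_in i) (@fprod_in_is_linear i).

Fact fprod_in_is_monoid_morphism i : monoid_morphism (@fprod_in i).
Proof.
split=> [|a b]; first exact/fpiP/fpeq_gen1.
by rewrite {2}/GRing.mul /= fp_mulE; apply/fpiP/fpeq_genM.
Qed.

HB.instance Definition _ i :=
  GRing.isMonoidMorphism.Build (A i) fprod (@fprod_in i)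
    (@fprod_in_is_monoid_morphism i).

Lemma fprod_exp_in i (a : A i) :
  nc_exp free_product (fprod_in a) = nc_exp (A i) a.
Proof.
by rewrite /= fprod_expE /fpterm_exp /= /fpact_gen /vacuum /= mulr1 addr0.
Qed.

Lemma fprod_exp_alternating (s : seq {i : I & A i}) : s != [::] ->
  all (fun p => nc_exp (A (tag p)) (tagged p) == 0) s ->
  sorted (fun p q => tag p != tag q) s ->
  nc_exp free_product (\prod_(p <- s) fprod_in (tagged p)) = 0.
Proof.
have pE (r : fpstack) : \prod_(p <- r) fprod_in (tagged p) =
    fpi (foldr (fun p t => FPmul (FPgen (tagged p)) t) FPone r).
  elim: r => [|p r IH]; first by rewrite big_nil.
  by rewrite big_cons IH [LHS]fp_mulE.
rewrite pE /= fprod_expE /fpterm_exp.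
have key F r : all (fun p => nc_exp (A (tag p)) (tagged p) == 0) r ->
    sorted (fun p q => tag p != tag q) r ->
    fpact (foldr (fun p t => FPmul (FPgen (tagged p)) t) FPone r) F [::] = F r.
  elim: r F => // [[i a] r IH] F /= /andP[/eqP a0 ar] sr.
  rewrite IH //; last exact: path_sorted sr.
  have push : nc_exp (A i) a * F r + F (Tagged A (centered a) :: r) =
      F (existT _ i a :: r) by rewrite centered_id // a0 mul0r add0r.
  case: r {IH ar} sr push => [|[j b] r] //= /andP[/eqP ij _].
  by rewrite /fpact_gen; case: eqP.
by case: s => // p s _ ps so; rewrite key.
Qed.

Section Universal.
Variables (B : algType K) (f : forall i, {lrmorphism A i -> B}).

Fixpoint fpeval (t : fpterm) : B :=
  match t with
  | FPgen i a => f i a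
  | FPzero => 0
  | FPone => 1
  | FPadd x y => fpeval x + fpeval y
  | FPmul x y => fpeval x * fpeval y
  | FPscale c x => c *: fpeval x
  end.

Lemma fpeval_eq t u : fpeq t u -> fpeval t = fpeval u.
Proof.
elim=> {t u} /=.
- by [].
- by move=> x y _ ->.
- by move=> x y z _ -> _ ->.
- by move=> x x' y y' _ -> _ ->.
- by move=> x x' y y' _ -> _ ->.
- by move=> c x x' _ ->.
- by move=> *; apply: addrA.
- by move=> *; apply: addrC.
- by move=> *; apply: add0r.
- by move=> x; rewrite scaleN1r addNr.
- by move=> *; apply: mulrA.
- by move=> *; apply: mul1r.
- by move=> *; apply: mulr1.
- by move=> *; apply: mulrDl.
- by move=> *; apply: mulrDr.
- by move=> *; apply: scalerA.
- by move=> *; apply: scale1r.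
- by move=> *; apply: scalerDr.
- by move=> x a b; rewrite scalerDl.
- by move=> *; apply: scalerAl.
- by move=> *; apply: scalerAr.
- by move=> i c a b; rewrite linearP.
- by move=> i a b; rewrite rmorphM.
- by move=> i; rewrite rmorph1.
Qed.

Definition fprod_lift (x : fprod) : B := fpeval (fprepr x).

Lemma fprod_liftE t : fprod_lift (fpi t) = fpeval t.
Proof. exact/fpeval_eq/fpreprE. Qed.

Fact fprod_lift_is_linear : linear fprod_lift.
Proof.
move=> c; elim/fprodW=> x; elim/fprodW=> y.
by rewrite {1}/GRing.add /GRing.scale /= fp_scaleE fp_addE !fprod_liftE.
Qed.

HB.instance Definition _ :=
  GRing.isLinear.Build K fprod B *:%R fprod_lift fprod_lift_is_linear.

Fact fprod_lift_is_monoid_morphism : monoid_morphism fprod_lift.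
Proof.
split; first exact: fprod_liftE.
elim/fprodW=> x; elim/fprodW=> y.
by rewrite {1}/GRing.mul /= fp_mulE !fprod_liftE.
Qed.

HB.instance Definition _ :=
  GRing.isMonoidMorphism.Build fprod B fprod_lift fprod_lift_is_monoid_morphism.

Lemma fprod_lift_in i (a : A i) : fprod_lift (fprod_in a) = f i a.
Proof. exact: fprod_liftE. Qed.

Lemma fprod_lift_unique (h : {lrmorphism fprod -> B}) :
  (forall i (a : A i), h (fprod_in a) = f i a) -> h =1 fprod_lift.
Proof.
move=> hf; elim/fprodW; elim=> [i a||| x IHx y IHy|x IHx y IHy|c x IHx].
- by rewrite hf fprod_lift_in.
- by rewrite (rmorph0 h) [RHS]fprod_liftE.
- by rewrite (rmorph1 h) [RHS]fprod_liftE.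
- have -> : fpi (FPadd x y) = fpi x + fpi y by rewrite -fp_addE.
  by rewrite !rmorphD /= IHx IHy.
- have -> : fpi (FPmul x y) = fpi x * fpi y by rewrite -fp_mulE.
  by rewrite !rmorphM /= IHx IHy.
- have -> : fpi (FPscale c x) = c *: fpi x by rewrite -fp_scaleE.
  by rewrite !linearZ /= IHx.
Qed.

End Universal.

End FreeProduct.

Record sgraph := SGraph {
  svertex :> finType;
  sedge : rel svertex;
  sedge_sym : symmetric sedge;
  sedge_irr : irreflexive sedge
}.

Section Paths.
Variable G : sgraph.

(* |w| = |{v_1, ..., v_(k+1)}| - 1 = k says that the v_i are distinct.        *)
Definition is_path (w : seq G) : bool :=
  [&& (1 < size w)%N, uniq w & sorted (@sedge G) w].

Definition opath := {w : seq G | is_path w}.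

Definition opath_eqrev (p q : opath) : bool :=
  (val p == val q) || (val p == rev (val q)).

Lemma opath_eqrev_equiv : equiv_class_of opath_eqrev.
Proof.
split=> [p|p q|q p r]; rewrite /opath_eqrev ?eqxx //.
  by apply/idP/idP => /orP[] /eqP ->; rewrite ?revK eqxx ?orbT.
by case/orP=> /eqP -> /orP[] /eqP ->; rewrite ?revK eqxx ?orbT.
Qed.

Canonical opath_eqrev_equiv_rel := EquivRelPack opath_eqrev_equiv.

(* FP(G): paths of length >= 1, a path being identified with its reversal.    *)
Definition FP := {eq_quot opath_eqrev}.

HB.instance Definition _ := Choice.on FP.

Definition FPverts (w : FP) : {set G} := [set v in val (repr w)].

Lemma FPvertsE (p : opath) : FPverts (\pi_FP p) = [set v in val p].
Proof.
apply/setP=> v; rewrite !inE.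
have /eqquotP/orP[] : repr (\pi_FP p) = p %[mod FP] by rewrite reprK.
  by move/eqP->.
by move/eqP->; rewrite mem_rev.
Qed.

(* The index set {None} + F^+(G) of A^G and D^G, [None] being the index of    *)
(* the first summand C.                                                       *)
Definition gindex := option (G + FP)%type.

End Paths.

Section DirectSum.
Variables (K : fieldType) (J : Type) (B : option J -> algType K).

Definition dsum := forall w, B w.

HB.instance Definition _ := Choice.on dsum.

Definition dsum_add (a b : dsum) : dsum := fun w => a w + b w.
Definition dsum_opp (a : dsum) : dsum := fun w => - a w.
Definition dsum_mul (a b : dsum) : dsum := fun w => a w * b w.
Definition dsum_scale c (a : dsum) : dsum := fun w => c *: a w.
Definition dsum_zero : dsum := fun=> 0.
Definition dsum_one : dsum := fun=> 1.

Fact dsum_addA : associative dsum_add.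
Proof.
by move=> a b c; apply: functional_extensionality_dep => w;
  apply: addrA.
Qed.
Fact dsum_addC : commutative dsum_add.
Proof.
by move=> a b; apply: functional_extensionality_dep => w;
  apply: addrC.
Qed.
Fact dsum_add0 : left_id dsum_zero dsum_add.
Proof.
by move=> a; apply: functional_extensionality_dep => w;
  apply: add0r.
Qed.
Fact dsum_addN : left_inverse dsum_zero dsum_opp dsum_add.
Proof.
by move=> a; apply: functional_extensionality_dep => w;
  apply: addNr.
Qed.

HB.instance Definition _ :=
  GRing.isZmodule.Build dsum dsum_addA dsum_addC dsum_add0 dsum_addN.

Fact dsum_mulA : associative dsum_mul.
Proof.
by move=> a b c; apply: functional_extensionality_dep => w;
  apply: mulrA.
Qed.
Fact dsum_mul1l : left_id dsum_one dsum_mul.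
Proof.
by move=> a; apply: functional_extensionality_dep => w;
  apply: mul1r.
Qed.
Fact dsum_mul1r : right_id dsum_one dsum_mul.
Proof.
by move=> a; apply: functional_extensionality_dep => w;
  apply: mulr1.
Qed.
Fact dsum_mulDl : left_distributive dsum_mul +%R.
Proof.
by move=> a b c; apply: functional_extensionality_dep => w;
  apply: mulrDl.
Qed.
Fact dsum_mulDr : right_distributive dsum_mul +%R.
Proof.
by move=> a b c; apply: functional_extensionality_dep => w;
  apply: mulrDr.
Qed.
Fact dsum_oner_neq0 : dsum_one != 0.
Proof.
apply/eqP=> /(congr1 (fun a : dsum => a None)) /eqP.
by rewrite /dsum_one oner_eq0.
Qed.

HB.instance Definition _ := GRing.Zmodule_isNzRing.Build dsum
  dsum_mulA dsum_mul1l dsum_mul1r dsum_mulDl dsum_mulDr dsum_oner_neq0.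

Fact dsum_scaleA c d (a : dsum) :
  dsum_scale c (dsum_scale d a) = dsum_scale (c * d) a.
Proof. by apply: functional_extensionality_dep => w; apply: scalerA. Qed.
Fact dsum_scale1 : left_id 1 dsum_scale.
Proof.
by move=> a; apply: functional_extensionality_dep => w;
  apply: scale1r.
Qed.
Fact dsum_scaleDr : right_distributive dsum_scale +%R.
Proof.
by move=> c a b; apply: functional_extensionality_dep => w;
  apply: scalerDr.
Qed.
Fact dsum_scaleDl (a : dsum) : {morph dsum_scale^~ a : c d / c + d}.
Proof.
by move=> c d; apply: functional_extensionality_dep => w;
  apply: scalerDl.
Qed.

HB.instance Definition _ := GRing.Zmodule_isLmodule.Build K dsum
  dsum_scaleA dsum_scale1 dsum_scaleDr dsum_scaleDl.

Fact dsum_scaleAl (c : K) (a b : dsum) : c *: (a * b) = c *: a * b.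
Proof. by apply: functional_extensionality_dep => w; apply: scalerAl. Qed.
HB.instance Definition _ := GRing.Lmodule_isLalgebra.Build K dsum dsum_scaleAl.

Fact dsum_scaleAr (c : K) (a b : dsum) : c *: (a * b) = a * (c *: b).
Proof. by apply: functional_extensionality_dep => w; apply: scalerAr. Qed.
HB.instance Definition _ := GRing.Lalgebra_isAlgebra.Build K dsum dsum_scaleAr.

End DirectSum.

Section GraphFreeProduct.
Variables (K : fieldType) (G : sgraph) (A : G -> ncps K).

(* As the vertices of a path w are distinct, A_(v_1) * ... * A_(v_k) is the   *)
(* free product indexed by the set of vertices of w.                          *)
Definition gspace (w : gindex G) : ncps K :=
  match w with
  | None => scalar_ncps K
  | Some (inl v) => A v
  | Some (inr p) =>
      free_product (fun v : {v : G | v \in FPverts p} => A (val v))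
  end.

Definition graph_alg := dsum (fun w => nc_alg (gspace w)).

HB.instance Definition _ := GRing.Algebra.on graph_alg.

Definition diag_alg := gindex G -> K.

HB.instance Definition _ := GRing.ComPzRing.on diag_alg.

Definition diag_in (d : diag_alg) : graph_alg := fun w => d w *: 1.

Definition graph_exp (a : graph_alg) : diag_alg :=
  fun w => nc_exp (gspace w) (a w).

End GraphFreeProduct.

Definition noncrossing m (P : {set {set 'I_m}}) : bool :=
  [forall B in P, forall C in P,
   forall a : 'I_m, forall b : 'I_m, forall c : 'I_m, forall d : 'I_m,
   [&& (a < b)%N, (b < c)%N & (c < d)%N] ==>
   [&& a \in B, b \in C, c \in B & d \in C] ==> (B == C)].

Lemma noncrossingP m (P : {set {set 'I_m}}) : reflect
  (forall B C, B \in P -> C \in P -> forall a b c d : 'I_m,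
     (a < b)%N -> (b < c)%N -> (c < d)%N ->
     a \in B -> b \in C -> c \in B -> d \in C -> B = C)
  (noncrossing P).
Proof.
apply: (iffP forall_inP) => [h B C BP CP a b c d ab bc cd aB bC cB dC|h B BP].
  move: (h B BP) => /forall_inP/(_ C CP).
  move=> /forallP/(_ a)/forallP/(_ b)/forallP/(_ c)/forallP/(_ d).
  by rewrite ab bc cd aB bC cB dC => /eqP.
apply/forall_inP=> C CP; do 4!apply/forallP=> ?.
apply/implyP=> /and3P[ab bc cd]; apply/implyP=> /and4P[aB bC cB dC].
by apply/eqP; apply: (h _ _ BP CP) ab bc cd aB bC cB dC.
Qed.

Definition NC n :=
  {P : {set {set 'I_n}} | partition P [set: 'I_n] && noncrossing P}.

HB.instance Definition _ n := Finite.on (NC n).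
HB.instance Definition _ n := SubType.on (NC n).

Definition nc_le n (P Q : NC n) : bool :=
  [forall B in val P, exists C in val Q, B \subset C].

Section NCOrder.
Variable n : nat.

Fact nc_le_refl : reflexive (@nc_le n).
Proof.
by move=> P; apply/forall_inP => B BP; apply/exists_inP; exists B.
Qed.

Fact nc_le_trans : transitive (@nc_le n).
Proof.
move=> Q P R /forall_inP PQ /forall_inP QR; apply/forall_inP => B /PQ.
case/exists_inP=> C /QR /exists_inP[D DR CD] BC.
by apply/exists_inP; exists D => //; apply: subset_trans CD.
Qed.

Fact nc_le_anti : antisymmetric (@nc_le n).
Proof.
suff half (P Q : NC n) : nc_le P Q -> nc_le Q P -> val P \subset val Q.
  move=> P Q /andP[PQ QP]; apply/val_inj/eqP.
  by rewrite eqEsubset !half.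
move=> /forall_inP PQ /forall_inP QP; apply/subsetP => B BP.
case/exists_inP: (PQ B BP) => C CQ BC.
case/exists_inP: (QP C CQ) => D DP CD.
have [tP P0] : trivIset (val P) /\ set0 \notin val P.
  by case/andP: (valP P) => /and3P[].
move/trivIsetP: tP => tP.
have BD : B = D.
  apply/eqP/negPn/negP => /(tP _ _ BP DP).
  rewrite -setI_eq0 (setIidPl (subset_trans BC CD)) => /eqP B0.
  by move: P0; rewrite -B0 BP.
suff -> : B = C by [].
by apply/eqP; rewrite eqEsubset BC BD.
Qed.

HB.instance Definition _ := Order.Le_isPOrder.Build (Order.Disp tt tt) (NC n)
  nc_le_refl nc_le_anti nc_le_trans.

Fact nc_one_subproof :
  partition ([set [set: 'I_n]] :\ set0) [set: 'I_n] &&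
  noncrossing ([set [set: 'I_n]] :\ set0).
Proof.
rewrite /partition !inE eqxx /= andbT -andbA; apply/and3P; split.
- apply/eqP/setP=> i; rewrite inE; apply/bigcupP; exists [set: 'I_n] => //.
  by rewrite !inE eqxx andbT; apply/set0Pn; exists i.
- apply/trivIsetP=> B C; rewrite !inE.
  by move=> /andP[_ /eqP->] /andP[_ /eqP->] /eqP.
- apply/forall_inP=> B; rewrite !inE => /andP[_ /eqP->].
  apply/forall_inP=> C; rewrite !inE => /andP[_ /eqP->].
  by do 4!apply/forallP=> ?; rewrite eqxx !implybT.
Qed.

(* The removal of [set0] only matters for n = 0.                              *)
Definition nc_one : NC n :=
  exist _ ([set [set: 'I_n]] :\ set0) nc_one_subproof.

End NCOrder.

(* The Moebius function of a finite poset; the fuel exceeds the length of     *)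
(* all chains, see [moebius_sum].                                             *)
Section Moebius.
Variables (d : Order.disp_t) (T : finPOrderType d).

Fixpoint moebius_rec (k : nat) (x y : T) : int :=
  if k is k'.+1 then
    if x == y then 1
    else - \sum_(z | (x <= z)%O && (z < y)%O) moebius_rec k' x z
  else 0.

Definition moebius (x y : T) : int := moebius_rec #|T| x y.

Lemma moebius_recE k x y : (x <= y)%O ->
  (#|[set z | (x <= z)%O && (z <= y)%O]| <= k)%N ->
  forall k', (k <= k')%N -> moebius_rec k' x y = moebius_rec k x y.
Proof.
elim: k y => [|k IH] y xy.
  rewrite leqn0 cards_eq0 => /eqP e.
  have : x \in set0 by rewrite -e inE lexx.
  by rewrite inE.
move=> ck [//|k'] kk' /=; case: eqP => // _; congr (- _).
apply: eq_bigr => z /andP[xz zy]; apply: IH => //.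
rewrite -ltnS; apply: leq_trans ck; apply: proper_card; apply/properP; split.
  apply/subsetP=> u; rewrite !inE => /andP[-> uz].
  exact: le_trans uz (ltW zy).
by exists y; rewrite !inE; [rewrite xy lexx|rewrite (lt_geF zy) andbF].
Qed.

Lemma moebius_sum x y : (x <= y)%O ->
  \sum_(z | (x <= z)%O && (z <= y)%O) moebius x z = (x == y)%:R.
Proof.
move=> xy; rewrite (bigD1 y) /=; last by rewrite xy lexx.
have -> : moebius x y = moebius_rec #|T|.+1 x y.
  by apply/esym/moebius_recE; rewrite ?max_card.
rewrite /=; have [->|nxy] := eqVneq x y.
  rewrite big1 ?addr0 // => z /andP[/andP[yz zy]].
  by rewrite eq_le yz zy.
rewrite addrC; apply/eqP; rewrite subr_eq0; apply/eqP.
by apply: eq_bigl => z; rewrite lt_neqAle; case: eqP; rewrite ?andbF ?andbT.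
Qed.

End Moebius.

(* NC(n) with 1 < 1bar < 2 < 2bar < ... < n < nbar: i and ibar are the points *)
(* 2i and 2i+1 of 'I_(2n).                                                    *)
Section Kreweras.
Variable n : nat.

Fact plain_subproof (i : 'I_n) : (i.*2 < n.*2)%N.
Proof. by rewrite ltn_double. Qed.
Fact barred_subproof (i : 'I_n) : (i.*2.+1 < n.*2)%N.
Proof. by rewrite ltn_Sdouble. Qed.

Definition plain (i : 'I_n) : 'I_n.*2 := Ordinal (plain_subproof i).
Definition barred (i : 'I_n) : 'I_n.*2 := Ordinal (barred_subproof i).

Definition interleave (P Q : {set {set 'I_n}}) : {set {set 'I_n.*2}} :=
  [set plain @: (B : {set 'I_n}) | B in P] :|:
  [set barred @: (B : {set 'I_n}) | B in Q].

Definition is_kreweras (P Q : NC n) : bool :=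
  noncrossing (interleave (val P) (val Q)) &&
  [forall Q' : NC n,
     noncrossing (interleave (val P) (val Q')) ==> (Q' <= Q)%O].

(* Every block of P is inside or outside the interval ]i, j]. *)
Definition kr_rel (P : {set {set 'I_n}}) (i j : 'I_n) : bool :=
  [forall B in P, forall a in B, forall b in B,
    ((i < a)%N (+) (j < a)%N) == ((i < b)%N (+) (j < b)%N)].

Lemma kr_relP (P : {set {set 'I_n}}) (i j : 'I_n) : reflect
  (forall B a b, B \in P -> a \in B -> b \in B ->
    (i < a)%N (+) (j < a)%N = (i < b)%N (+) (j < b)%N) (kr_rel P i j).
Proof.
apply: (iffP forall_inP) => [h B a b BP aB bB|h B BP].
  by move/(_ B BP): h => /forall_inP/(_ a aB)/forall_inP/(_ b bB)/eqP.
by apply/forall_inP=> a aB; apply/forall_inP=> b bB; apply/eqP/(h B).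
Qed.

Lemma kr_rel_equiv (P : {set {set 'I_n}}) :
  {in [set: 'I_n] & &, equivalence_rel (kr_rel P)}.
Proof.
have sym i j : kr_rel P i j -> kr_rel P j i.
  move=> /kr_relP h; apply/kr_relP=> B a b BP aB bB.
  by rewrite addbC (h B a b) // addbC.
have tr i j k : kr_rel P i j -> kr_rel P j k -> kr_rel P i k.
  move=> /kr_relP h /kr_relP h'; apply/kr_relP=> B a b BP aB bB.
  move: (h B a b BP aB bB) (h' B a b BP aB bB).
  by do 6![case: (_ < _)%N].
move=> i j k _ _ _; split.
  by apply/kr_relP=> B a b *; rewrite !addbb.
move=> ij; apply/idP/idP; [exact/tr/sym|exact: tr ij].
Qed.

Definition kr_blocks (P : {set {set 'I_n}}) :=
  equivalence_partition (kr_rel P) [set: 'I_n].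

Lemma kr_blocks_rel P B i j : B \in kr_blocks P -> i \in B -> j \in B ->
  kr_rel P i j.
Proof.
case/imsetP=> k _ -> ; rewrite !inE /= => ki kj.
have [_ /(_ ki) e] := kr_rel_equiv P (in_setT k) (in_setT i) (in_setT j).
by rewrite -e.
Qed.

Lemma kr_rel_blocks P i j : kr_rel P i j ->
  exists2 B, B \in kr_blocks P & (i \in B) && (j \in B).
Proof.
move=> ij; exists [set k in [set: 'I_n] | kr_rel P i k].
  by apply/imsetP; exists i.
by rewrite !inE ij !andbT; apply/kr_relP => *; rewrite !addbb.
Qed.

Lemma kr_blocks_nc (P : {set {set 'I_n}}) : noncrossing (kr_blocks P).
Proof.
have /and3P[_ tQ _] := equivalence_partitionP (kr_rel_equiv P).
apply/noncrossingP=> B C BQ CQ a b c d ab bc cd aB bC cB dC.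
suff /kr_rel_blocks[D DQ /andP[aD bD]] : kr_rel P a b.
  by rewrite -(def_pblock tQ BQ aB) (def_pblock tQ DQ aD)
             -(def_pblock tQ CQ bC) (def_pblock tQ DQ bD).
apply/kr_relP=> U u v UP uU vU.
move/kr_relP: (kr_blocks_rel BQ aB cB) => /(_ U u v UP uU vU).
move/kr_relP: (kr_blocks_rel CQ bC dC) => /(_ U u v UP uU vU).
have lt_imp (x y z : 'I_n) : (x < y)%N -> (y < z)%N ==> (x < z)%N.
  by move=> xy; apply/implyP; apply: ltn_trans.
move: (lt_imp a b u ab) (lt_imp b c u bc) (lt_imp c d u cd).
move: (lt_imp a b v ab) (lt_imp b c v bc) (lt_imp c d v cd).
case: (a < u)%N; case: (b < u)%N; case: (c < u)%N; case: (d < u)%N => //=;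
by case: (a < v)%N; case: (b < v)%N; case: (c < v)%N; case: (d < v)%N.
Qed.

Lemma interleave_nc (P : NC n) :
  noncrossing (interleave (val P) (kr_blocks (val P))).
Proof.
have /noncrossingP ncP : noncrossing (val P) by case/andP: (valP P).
have /noncrossingP ncQ := kr_blocks_nc (val P).
apply/noncrossingP=> X Y; rewrite !inE.
case/orP=> /imsetP[B BP ->]; case/orP=> /imsetP[C CP ->] a b c d ab bc cd;
move=> /imsetP[a' aB ea] /imsetP[b' bC eb] /imsetP[c' cB ec] /imsetP[d' dC ed];
move: ab bc cd; rewrite ea eb ec ed /=.
- rewrite !ltn_double => ab bc cd; suff -> : B = C by [].
  exact: (ncP _ _ BP CP a' b' c' d').
- rewrite ltnS leq_double ltn_Sdouble ltnS leq_double => ab bc cd.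
  have /kr_relP/(_ B a' c' BP aB cB) := kr_blocks_rel CP bC dC.
  by rewrite bc !ltnNge ab (leq_trans ab (leq_trans (ltnW bc) cd)) cd.
- rewrite ltn_Sdouble ltnS leq_double ltn_Sdouble => ab bc cd.
  have /kr_relP/(_ C b' d' CP bC dC) := kr_blocks_rel BP aB cB.
  by rewrite ab cd (ltn_trans ab (leq_ltn_trans bc cd)) ltnNge bc.
- rewrite !ltnS !ltn_double => ab bc cd; suff -> : B = C by [].
  exact: (ncQ _ _ BP CP a' b' c' d').
Qed.

Lemma interleave_kr_rel (P Q : {set {set 'I_n}}) (B : {set 'I_n}) i j :
  noncrossing (interleave P Q) -> B \in Q -> i \in B -> j \in B ->
  kr_rel P i j.
Proof.
move=> /noncrossingP nc BQ.
have cross (U : {set 'I_n}) lo hi u v : U \in P -> lo \in B -> hi \in B ->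
    u \in U -> v \in U -> (lo < u)%N -> (u <= hi)%N ->
    (v <= lo)%N || (hi < v)%N -> False.
  move=> UP loB hiB uU vU lou uhi vout.
  have PU : plain @: U \in interleave P Q.
    by rewrite inE; apply/orP; left; apply: imset_f.
  have BB : barred @: B \in interleave P Q.
    by rewrite inE; apply/orP; right; apply: imset_f.
  have ne : plain @: U <> barred @: B.
    move=> e; have : plain u \in barred @: B by rewrite -e imset_f.
    by case/imsetP=> x _ /(congr1 (odd \o val)) /=; rewrite !odd_double.
  case/orP: vout => vl.
    apply: ne.
    apply: (nc _ _ PU BB (plain v) (barred lo) (plain u) (barred hi));
      rewrite ?imset_f //= ?ltnS ?leq_double //.
    by rewrite ltn_Sdouble.
  apply/ne/esym.
  apply: (nc _ _ BB PU (barred lo) (plain u) (barred hi) (plain v));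
    by rewrite ?imset_f //= ?ltnS ?ltn_Sdouble ?leq_double.
move=> iB jB; apply/kr_relP=> U a b UP aU bU.
have X := cross U _ _ _ _ UP.
case: (ltnP i a) => ia; case: (ltnP j a) => ja; case: (ltnP i b) => ib;
  case: (ltnP j b) => jb //=; exfalso;
by [apply: (X i j a b) => //; rewrite ?ib ?jb ?orbT
   |apply: (X j i a b) => //; rewrite ?ib ?jb ?orbT
   |apply: (X i j b a) => //; rewrite ?ia ?ja ?orbT
   |apply: (X j i b a) => //; rewrite ?ia ?ja ?orbT].
Qed.

Lemma Kr_exists (P : NC n) : exists Q, is_kreweras P Q.
Proof.
have pQ : partition (kr_blocks (val P)) [set: 'I_n] &&
    noncrossing (kr_blocks (val P)).
  by rewrite (equivalence_partitionP (kr_rel_equiv _)) kr_blocks_nc.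
exists (exist _ (kr_blocks (val P)) pQ); rewrite /is_kreweras interleave_nc /=.
apply/forallP=> Q; apply/implyP=> ncQ; apply/forall_inP=> B BQ.
have /set0Pn[i iB] : B != set0.
  case/andP: (valP Q) => /and3P[_ _ /negP Q0] _.
  by apply/eqP=> B0; apply: Q0; rewrite -B0.
apply/exists_inP; exists [set k in [set: 'I_n] | kr_rel (val P) i k].
  by apply/imsetP; exists i.
by apply/subsetP=> j jB; rewrite !inE (interleave_kr_rel ncQ BQ iB jB).
Qed.

Definition Kr (P : NC n) : NC n := xchoose (Kr_exists P).

Lemma KrP P : is_kreweras P (Kr P).
Proof. exact: xchooseP. Qed.

End Kreweras.

Section Cumulants.
Variables (K : fieldType) (G : sgraph) (A : G -> ncps K).

Local Notation AG := (graph_alg A).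
Local Notation DG := (diag_alg K G).

(* Ordinals are enumerated in increasing order, so [\prod_(i in V) x i] is    *)
(* the product in increasing order of indices.                                *)
Definition cumulant n (x : 'I_n -> AG) : DG :=
  \sum_(P : NC n)
    (\prod_(V in val P) graph_exp (\prod_(i in V) x i)) *
    (moebius P (nc_one n))%:~R.

Definition cumulant_pi n (P : NC n) (x : 'I_n -> AG) : DG :=
  \prod_(V in val P) cumulant (fun j : 'I_#|V| => x (enum_val j)).

Definition Gfree_subalg (A1 A2 : set AG) : Prop :=
  forall n (i : 'I_n -> bool) (a : 'I_n -> AG), (2 <= n)%N ->
    (forall j, (if i j then A1 else A2) (a j)) ->
    (exists j k, i j != i k) ->
    cumulant a = 0.

Definition subalg_gen (X : set AG) : set AG :=
  smallest (fun B : set AG => GRing.subalg_closed (mem B)) X.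

Definition Gfree (X1 X2 : set AG) : Prop :=
  Gfree_subalg (subalg_gen (X1 `|` range (@diag_in K G A))%classic)
               (subalg_gen (X2 `|` range (@diag_in K G A))%classic).

(* D^G[[z_1, ..., z_s]]: the word [:: i_1; ...; i_n] stands for the monomial  *)
(* z_(i_1) ... z_(i_n); [ncseries_of c] is the sum, over n >= 1 and i, of     *)
(* c n i z_(i 1) ... z_(i n). For s = 1 this is D^G[[z]].                     *)
Definition ncseries (s : nat) := seq 'I_s -> DG.

Definition ncseries_of s (c : forall n, ('I_n -> 'I_s) -> DG) : ncseries s :=
  fun w => if w is [::] then 0 else c (size w) (tnth (in_tuple w)).

Definition Rtransform s (x : 'I_s -> AG) : ncseries s :=
  ncseries_of (fun n i => cumulant (fun k : 'I_n => x (i k))).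

Definition boxed_conv s (x y : 'I_s -> AG) : ncseries s :=
  ncseries_of (fun n i => \sum_(P : NC n)
    cumulant_pi P (fun k => x (i k)) * cumulant_pi (Kr P) (fun k => y (i k))).

End Cumulants.

(* Main.v *)
Require Import Defs.
From mathcomp Require Import all_boot all_order all_algebra.
From mathcomp Require Import boolp classical_sets functions reals.
From mathcomp Require Import complex.
From mathcomp Require Import zify.
(* Last, for the unqualified names to be those of fintype and finset. *)
From mathcomp Require Import fintype finset.

Set Implicit Arguments.
Unset Strict Implicit.
Unset Printing Implicit Defensive.

Import Order.TTheory GRing.Theory.
Local Open Scope ring_scope.

(* Interleave x and y to a sequence a of length 2n. The moment of the         *)
(* products x_i y_i is a moment of a, hence the sum of the cumulants of a     *)
(* over NC(2n). As mixed cumulants vanish, only the partitions that are the   *)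
(* interleaving of some P and Q contribute, and interleaving P and Q is       *)
(* noncrossing exactly when Q <= Kr P. For P fixed, T |-> T /\ Kr P is a      *)
(* bijection from [P, 1] to [0, Kr P], with inverse Q |-> P \/ Q, and         *)
(* T /\ Kr P restricts on each block of T to the Kreweras complement of P     *)
(* there. Hence the moment is the sum over T of the products, over the blocks *)
(* of T, of the right-hand sides of the claim, and these, satisfying the      *)
(* moment-cumulant formula, are the cumulants of the x_i y_i.                 *)

(** The combinatorics is done with relations instead of partitions. Two indices r, s lie in the same
    block of the Kreweras complement of P exactly when the interval ]r, s] is a union of blocks of
    P, and joins are described by the intervals saturated for both partitions. In these terms the
    bijection T |-> T /\ Kr P rests on three separation arguments, each of which exhibits one
    saturated interval: [meet_krel_sub], [sub_jrel_meet] and [krel_separates]. They are assembled in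
    [joinS_rel_krS] and [rel_krS_joinS]. The restriction to blocks comes from [krel_restrict],
    through [krS_restr], and the outcome is the purely combinatorial identity [sum_boxed].

    On the side of the functionals, [moment_cumulant] inverts the definition of cumulants by Moebius
    inversion, [block_cumulant_mixed] applies freeness, and [sum_interleave] turns the surviving
    partitions of 2n points into pairs (P, Q) with Q <= Kr P. Together with [sum_boxed] these give
    the moment formula [moment_mul]. Since a moment-cumulant formula determines its cumulants
    recursively, [block_cumulant_mul] identifies those of the products.

    All of this is carried out on arbitrary subsets S of the indices, because blocks of partitions
    are themselves partitioned again. *)

(** * Noncrossing relations and unions of intervals *)

(* The boolean atoms are cleared as [lia] would branch on each of them. *)
Ltac ord_lia :=
  repeat match goal with
  | H : is_true (?p ?x ?y) |- _ => is_var p; clear H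
  | H : is_true (~~ ?p ?x ?y) |- _ => is_var p; clear H
  | H : is_true (?f ?p ?x ?y) |- _ => is_var p; clear H
  | H : is_true (?f ?p ?q ?x ?y) |- _ => is_var p; is_var q; clear H
  | H : forall _, _ |- _ => clear H
  end; lia.

Section IntervalRelations.
Variable n : nat.
Implicit Types (p q t : rel 'I_n) (r s i j a b : 'I_n).

Definition between r s i := (r < i)%N (+) (s < i)%N.

Lemma betweenC r s i : between r s i = between s r i. Proof. exact: addbC. Qed.

(* ]r, s] is a union of p-classes; compare [kr_rel]. *)
Definition krel p r s :=
  [forall a, forall b, p a b ==> (between r s a == between r s b)].

Lemma krelP p r s :
  reflect (forall a b, p a b -> between r s a = between r s b) (krel p r s).
Proof.
apply: (iffP forallP) => [h a b pab|h a].
  by move: (h a) => /forallP/(_ b)/implyP/(_ pab)/eqP.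
by apply/forallP=> b; apply/implyP=> /h/eqP.
Qed.

(* For noncrossing partitions this is their join, see [joinS_rel_krS]: no     *)
(* closure is needed as intervals suffice to separate its blocks.             *)
Definition jrel p q i j :=
  [forall r, forall s, krel p r s ==>
    (krel q r s ==> (between r s i == between r s j))].

Lemma jrelP p q i j : reflect
  (forall r s, krel p r s -> krel q r s -> between r s i = between r s j)
  (jrel p q i j).
Proof.
apply: (iffP forallP) => [h r s pr qr|h r].
  by move: (h r) => /forallP/(_ s)/implyP/(_ pr)/implyP/(_ qr)/eqP.
by apply/forallP=> s; apply/implyP=> pr; apply/implyP=> qr; apply/eqP/h.
Qed.

(** For a symmetric and transitive [p], the conclusion [p a b] says that the two crossing classes
    coincide. *)
Definition nc_rel p := forall a b c d : 'I_n,
  (a < b)%N -> (b < c)%N -> (c < d)%N -> p a c -> p b d -> p a b.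

Lemma krel_refl p : reflexive (krel p).
Proof. by move=> i; apply/krelP => a b _; rewrite /between !addbb. Qed.

Lemma krel_sym p : symmetric (krel p).
Proof.
suff h i j : krel p i j -> krel p j i by move=> i j; apply/idP/idP; apply: h.
move=> /krelP h; apply/krelP=> a b pab.
by rewrite !(betweenC j) (h _ _ pab).
Qed.

Lemma krel_trans p : transitive (krel p).
Proof.
move=> j i k /krelP h /krelP h'; apply/krelP=> a b pab.
move: (h a b pab) (h' a b pab); rewrite /between.
by do 6![case: (_ < _)%N].
Qed.

Lemma jrel_refl p q : reflexive (jrel p q).
Proof. by move=> i; apply/jrelP. Qed.

Lemma jrel_sym p q : symmetric (jrel p q).
Proof.
suff h i j : jrel p q i j -> jrel p q j i.
  by move=> i j; apply/idP/idP; apply: h.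
by move=> /jrelP h; apply/jrelP => r s pr qr; rewrite h.
Qed.

Lemma jrel_trans p q : transitive (jrel p q).
Proof.
by move=> j i k /jrelP h /jrelP h'; apply/jrelP=> r s pr qr; rewrite h ?h'.
Qed.

Lemma krel_sub p q : subrel p q -> subrel (krel q) (krel p).
Proof. by move=> pq r s /krelP h; apply/krelP=> a b /pq/h. Qed.

Lemma krel_intro p r s : symmetric p ->
  (forall a b, p a b -> between r s a -> between r s b) -> krel p r s.
Proof.
by move=> sp h; apply/krelP=> a b pab; apply/idP/idP; apply: h; rewrite // sp.
Qed.

Lemma between_le r s i : (r <= s)%N -> between r s i = (r < i <= s)%N.
Proof. rewrite /between; lia. Qed.

(** For a < b < c < d the interval ]a, b] is ]a, c] minus ]b, d], and a difference of saturated sets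
    is saturated. *)
Lemma krel_nc p : nc_rel (krel p).
Proof.
move=> a b c d ab bc cd /krelP ac /krelP bd; apply/krelP=> u v puv.
move: (ac _ _ puv) (bd _ _ puv); rewrite /between; lia.
Qed.

(** An interval that agrees on a and c, and on b and d, but not on a and b would be entered or left
    three times along a < b < c < d. *)
Lemma jrel_nc p q : nc_rel (jrel p q).
Proof.
move=> a b c d ab bc cd /jrelP ac /jrelP bd; apply/jrelP=> r s pr qr.
move: (ac _ _ pr qr) (bd _ _ pr qr); rewrite /between; lia.
Qed.

Lemma min_elt (D : pred 'I_n) i : D i ->
  exists2 m, D m & forall k, D k -> (m <= k)%N.
Proof. by move=> Di; case: (arg_minnP val Di) => m Dm mm; exists m. Qed.

Lemma max_elt (D : pred 'I_n) i : D i ->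
  exists2 m, D m & forall k, D k -> (k <= m)%N.
Proof. by move=> Di; case: (arg_maxnP val Di) => m Dm mm; exists m. Qed.

(** The half (P \/ Q) /\ Kr P <= Q, for Q <= Kr P. If i and j lie in different classes of [q], an
    interval saturated for both relations separates them: it ends at the maximum of the class of j
    and starts just before the class, at a point in the same Kreweras class as i. *)
Lemma meet_krel_sub p q i j : symmetric q -> transitive q -> nc_rel q ->
  subrel q (krel p) -> q i i -> q j j -> krel p i j -> jrel p q i j -> q i j.
Proof.
move=> sq tq nq qp.
(* [m i] is the least element of the class of i; outside the domain of [q] its value is
   arbitrary. *)
have [m qm mm] : exists2 m : 'I_n -> 'I_n, forall i, q i i -> q i (m i) &
    forall i k, q i k -> (m i <= k)%N.
  have ex k : {m | q k k -> q k m /\ forall l, q k l -> (m <= l)%N}.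
    have [qk|nqk] := boolP (q k k); last by exists k; rewrite (negbTE nqk).
    by case: (arg_minnP val qk) => m qm mm; exists m.
  exists (fun k => sval (ex k)) => [k qk|k l qkl].
    by case: (svalP (ex k) qk).
  have qk : q k k by apply: (tq _ _ _ qkl); rewrite sq.
  by case: (svalP (ex k) qk) => _; apply.
wlog lt_m : i j / (m i < m j)%N.
  move=> W qi qj ij ji.
  have [lt|lt|/val_inj e] := ltngtP (m i) (m j); first exact: W.
    by rewrite sq; apply: W; rewrite // (krel_sym, jrel_sym).
  by apply: tq (qm _ qi) _; rewrite e sq; apply: qm.
move=> qi qj ij ji; exfalso.
(* The separating interval is ]p0, s]. Taking [p0] maximal below [m j] prevents classes of [q] from
   leaving it on the left. *)
have [|p0 /andP[ip0 p0m] p0max] :=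
  @max_elt (fun w => krel p i w && (w < m j)%N) (m i).
  by rewrite qp ?qm.
have [s js smax] := max_elt qj.
have ijs : krel p i s by apply: krel_trans ij (qp _ _ js).
have ijm : krel p i (m j) by apply: krel_trans ij (qp _ _ (qm _ qj)).
have kps : krel p p0 s by apply: krel_trans ijs; rewrite krel_sym.
have kpm : krel p p0 (m j) by apply: krel_trans ijm; rewrite krel_sym.
have mjs : (m j <= s)%N by apply: mm.
have p0s : (p0 <= s)%N by ord_lia.
have qms : q (m j) s by apply: tq js; rewrite sq; apply: qm.
have kqs : krel q p0 s.
  apply: krel_intro => // a b qab; rewrite !between_le // => /andP[p0a as_].
  apply/negPn/negP => nb.
  have [ja|nja] := boolP (q j a).
    have jb := tq _ _ _ ja qab.
    by move: (mm _ _ jb) (smax _ jb) => *; ord_lia.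
  have nma : q (m j) a -> False.
    by move=> h; move/negP: nja; apply; apply: tq h; apply: qm.
  have nas : a != s by apply: contraNneq nja => ->.
  have {}as_ : (a < s)%N by move: nas; rewrite -val_eqE /=; ord_lia.
  have [ma|am] := leqP (m j) a.
    have {}ma : (m j < a)%N.
      rewrite ltn_neqAle ma andbT val_eqE; apply/negP => /eqP e.
      by move/negP: nja; apply; rewrite -e; apply: qm.
    have [bs|bs] := ltnP s b; first exact: nma (nq _ _ _ _ ma as_ bs qms qab).
    have bm : (b < m j)%N by ord_lia.
    apply: nma; apply: tq (_ : q b a); last by rewrite sq.
    by rewrite sq; apply: nq bm ma as_ _ qms; rewrite sq.
  (* Here p0 < a < m j. If b is outside ]p0, s], then b is [p0] or the Kreweras class of a and b
     crosses that of p0 and m j; either way a joins the class of [p0], against maximality. *)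
  have npa : krel p p0 a -> False.
    move=> h; have := p0max a; rewrite (krel_trans ip0 h) am => /(_ isT).
    ord_lia.
  have kab := qp _ _ qab.
  have [bs|bs] := ltnP s b.
    by apply/npa/(krel_nc p0a am _ kpm kab); ord_lia.
  have [e|bp0] := eqVneq b p0; first by apply: npa; rewrite krel_sym -e.
  have {}bp0 : (b < p0)%N by move: bp0; rewrite -val_eqE /=; ord_lia.
  apply: npa; apply: krel_trans (_ : krel p b a); last by rewrite krel_sym.
  by rewrite krel_sym; apply: krel_nc bp0 p0a am _ kpm; rewrite krel_sym.
move/jrelP: ji => /(_ _ _ kps kqs).
move/krelP: (kqs) => /(_ _ _ (qm _ qi)) ->.
move/krelP: (kqs) => /(_ _ _ (qm _ qj)) ->.
rewrite !between_le // p0m mjs /=.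
have := p0max (m i); rewrite qp ?qm // lt_m => /(_ isT).
ord_lia.
Qed.

(** The half T <= P \/ (T /\ Kr P), for P <= T. Along a class of [t], a jointly saturated interval
    cannot change its value: at the first change, the two consecutive elements are linked by a step
    in [p] and a step in T /\ Kr P. *)
Lemma sub_jrel_meet p t i j : symmetric p -> transitive p -> nc_rel p ->
  symmetric t -> transitive t -> nc_rel t ->
  subrel p t -> (forall k, t k k -> p k k) -> t i j ->
  jrel p (fun k l => t k l && krel p k l) i j.
Proof.
move=> sp tp np st tt nt pt sup tij; apply/jrelP=> r s kp kq.
have ti : t i i by apply: (tt _ _ _ tij); rewrite st.
have [v0 tv0 v0min] := min_elt ti.
suff h v : t i v -> between r s v = between r s v0 by rewrite !h.
move=> tiv; apply/eqP/negPn/negP => nv.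
(* j becomes the first element of the class on the other side of ]r, s] from the minimum [v0]; hence
   it is also the least element of its class for [p]. *)
have [|{tij}j /andP[tij nj] jmin] :=
  @min_elt (fun v => t i v && (between r s v != between r s v0)) v.
  by rewrite tiv.
have {}v0j : (v0 < j)%N.
  rewrite ltn_neqAle v0min // andbT; apply: contraNneq nj.
  by move/val_inj->.
(* u is the predecessor of j in the class of [t]. *)
have [|u /andP[tiu uj] umax] :=
  @max_elt (fun v => t i v && (v < j)%N) v0.
  by rewrite tv0.
have iu : between r s u = between r s v0.
  apply/eqP/negPn/negP => nu; have := jmin u; rewrite tiu nu => /(_ isT).
  ord_lia.
have tuj : t u j by apply: tt tij; rewrite st.
have pj : p j j by apply: sup; rewrite (tt u) // st.
have jb b : p j b -> between r s b = between r s j.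
  by move=> pjb; move/krelP: kp => /(_ _ _ pjb).
have [m pjm mmax] := max_elt pj.
have jB b : p j b -> (j <= b)%N.
  by move=> pjb; apply: jmin; rewrite jb // nj andbT (tt j) // pt.
have jm := jB _ pjm.
have um : (u <= m)%N by ord_lia.
(* With m the last element of the [p]-class of j, the interval ]u, m] is saturated: a class of [p]
   leaving it would cross that class, or meet the class of [t] strictly between u and j. *)
have kum : krel p u m.
  apply: krel_intro => // a b pab; rewrite !between_le // => /andP[ua am].
  apply/negPn/negP => nb.
  have [pja|npja] := boolP (p j a).
    have pjb := tp _ _ _ pja pab.
    by move: (jB _ pjb) (mmax _ pjb); ord_lia.
  have nam : a != m by apply: contraNneq npja => ->.
  have naj : a != j by apply: contraNneq npja => ->.
  have {}am : (a < m)%N by move: nam; rewrite -val_eqE /=; ord_lia.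
  have [ja|aj] := ltnP j a.
    move/negP: npja; apply.
    have [bm|bm] := ltnP m b; first exact: np ja am bm pjm pab.
    have bj : (b < j)%N by ord_lia.
    apply: tp (_ : p b a); last by rewrite sp.
    by rewrite sp; apply: np bj ja am _ pjm; rewrite sp.
  have {naj}aj : (a < j)%N by move: naj; rewrite -val_eqE /=; ord_lia.
  have nta : t u a -> False.
    move=> tua; have := umax a; rewrite aj (tt _ _ _ tiu tua) => /(_ isT).
    ord_lia.
  have tab := pt _ _ pab.
  have [bm|bm] := ltnP m b.
    by apply/nta/(nt _ _ _ _ ua aj _ tuj tab); ord_lia.
  have [e|bu] := eqVneq b u; first by apply: nta; rewrite st -e.
  have {}bu : (b < u)%N by move: bu; rewrite -val_eqE /=; ord_lia.
  apply: nta; apply: tt (_ : t b a); last by rewrite st.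
  by rewrite st; apply: nt bu ua aj _ tuj; rewrite st.
have tum : t u m by apply: tt tuj (pt _ _ pjm).
move/krelP: kq => /(_ u m); rewrite tum kum iu (jb m) // => /(_ isT) e.
by rewrite -e eqxx in nj.
Qed.

(** Of two distinct noncrossing classes, consider the one whose minimum is larger. Its convex hull
    is saturated, and it misses the minimum of the other class. *)
Lemma krel_separates t i j : symmetric t -> transitive t -> nc_rel t ->
  t i i -> t j j ->
  (forall r s, krel t r s -> between r s i = between r s j) -> t i j.
Proof.
move=> st tt nt.
suff W i' j' m m' : t i' m -> (forall k, t i' k -> (m <= k)%N) ->
    t j' m' -> (forall k, t j' k -> (m' <= k)%N) -> (m < m')%N ->
    t i' i' -> t j' j' ->
    (forall r s, krel t r s -> between r s i' = between r s j') -> t i' j'.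
  move=> ti tj h.
  have [m tm mm] := min_elt ti; have [m' tm' mm'] := min_elt tj.
  have [lt|lt|/val_inj e] := ltngtP m m'; first exact: (W i j m m').
    by rewrite st; apply: (W j i m' m) => // r s /h.
  by apply: (tt m); rewrite // e st.
move=> {i j}tim mmin; set i := i' in tim mmin *; set j := j'.
move=> tjm mmin' lt ti tj h; exfalso.
have [s tjs smax] := max_elt tj.
(* Intervals are open on the left, so the hull of the class of j starts at m' - 1; this is a genuine
   predecessor because m < m'. *)
have rP : (m'.-1 < n)%N by have := ltn_ord m'; ord_lia.
pose r := Ordinal rP.
have rm : r.+1 = m' :> nat by rewrite /=; ord_lia.
have ms : (m' <= s)%N by apply: mmin'.
have rs : (r <= s)%N by ord_lia.
have tms : t m' s by apply: tt tjs; rewrite st.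
have ki : krel t r s.
  apply: krel_intro => // a b tab; rewrite !between_le // rm => /andP[ma as_].
  have [tja|ntja] := boolP (t j a).
    have tjb := tt _ _ _ tja tab.
    by rewrite mmin' ?smax.
  apply/negPn/negP => nb.
  have nma : t m' a -> False.
    by move=> h'; move/negP: ntja; apply; apply: tt tjm h'.
  have nas : a != s by apply: contraNneq ntja => ->.
  have nam : a != m' by apply: contraNneq ntja => ->.
  have {}as_ : (a < s)%N by move: nas; rewrite -val_eqE /=; ord_lia.
  have {nam}ma : (m' < a)%N by move: nam; rewrite -val_eqE /=; ord_lia.
  have [bs|bs] := ltnP s b; first exact: nma (nt _ _ _ _ ma as_ bs tms tab).
  have bm : (b < m')%N by ord_lia.
  apply: nma; apply: tt (_ : t b a); last by rewrite st.
  by rewrite st; apply: nt bm ma as_ _ tms; rewrite st.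
have := h _ _ ki.
move/krelP: (ki) => /(_ _ _ tim) ->; move/krelP: (ki) => /(_ _ _ tjm) ->.
rewrite !between_le // rm leqnn ms; ord_lia.
Qed.

(** Every other class of [t] is, by noncrossing, entirely inside or entirely outside ]i, j], so the
    classes of [p] contained in it impose no condition. *)
Lemma krel_restrict p t i j : symmetric p -> subrel p t ->
  symmetric t -> transitive t -> nc_rel t -> t i j ->
  krel (fun a b => p a b && t i a) i j = krel p i j.
Proof.
move=> sp pt st tt nt tij; apply/idP/idP; last first.
  by apply: krel_sub => a b /andP[].
wlog ij : i j tij / (i <= j)%N.
  move=> W; have [/(W _ _ tij)//|/ltnW ji] := leqP i j.
  rewrite ![krel _ i j]krel_sym => h; apply: W => //; first by rewrite st.
  apply: krel_sub h => a b /andP[-> ja].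
  by rewrite (tt j).
move=> /krelP h; apply: krel_intro => // a b pab.
have [tia|ntia] := boolP (t i a); first by rewrite (h a b) // pab.
rewrite !between_le // => /andP[ia aj]; apply/negPn/negP => nb.
have naj : a != j by apply: contraNneq ntia => ->.
have {naj}aj : (a < j)%N by move: naj; rewrite -val_eqE /=; ord_lia.
have tab := pt _ _ pab.
have nbi : b != i by apply: contraNneq ntia => <-; rewrite st.
have {}nbi : (b != i :> nat) by rewrite val_eqE.
move/negP: ntia; apply.
have [jb|bj] := ltnP j b; first exact: nt ia aj jb tij tab.
have bi : (b < i)%N by ord_lia.
apply: (tt b); rewrite // st //.
by apply: nt bi ia aj _ tij; rewrite st.
Qed.

End IntervalRelations.

(** * Noncrossing partitions of a set of indices *)

Section PartitionRelations.
Variable n : nat.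
Implicit Types (P Q T : {set {set 'I_n}}) (S V B : {set 'I_n}) (R : rel 'I_n).

(** For a partition of S this is an equivalence relation on S only, whence the reflexivity
    hypotheses such as [q i i] in the lemmas on relations. *)
Definition same P : rel 'I_n :=
  fun i j => [exists B in P, (i \in B) && (j \in B)].

Lemma sameP P i j :
  reflect (exists B, [/\ B \in P, i \in B & j \in B]) (same P i j).
Proof.
apply: (iffP exists_inP) => [[B BP /andP[iB jB]]|[B [BP iB jB]]].
  by exists B.
by exists B; rewrite ?iB.
Qed.

Lemma same_sym P : symmetric (same P).
Proof. by move=> i j; apply: eq_existsb => B; rewrite (andbC (i \in B)). Qed.

Lemma same_block P B i j : trivIset P -> B \in P -> i \in B ->
  same P i j = (j \in B).
Proof.
move=> tP BP iB; apply/sameP/idP => [[C [CP iC jC]]|jB]; last by exists B.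
by rewrite -(def_pblock tP BP iB) (def_pblock tP CP iC).
Qed.

Lemma same_trans P : trivIset P -> transitive (same P).
Proof.
move=> tP j i k /sameP[B [BP iB jB]].
by rewrite (same_block _ tP BP jB) (same_block _ tP BP iB).
Qed.

Lemma partition_block_mem P S B : partition P S -> B \in P -> exists i, i \in B.
Proof.
case/and3P => _ _ P0 BP; apply/set0Pn.
by apply: contraNneq P0 => <-.
Qed.

Lemma same_cover P S i : partition P S -> same P i i = (i \in S).
Proof.
case/and3P => /eqP <- _ _; apply/sameP/bigcupP => [[B [BP iB _]]|[B BP iB]];
  by exists B.
Qed.

Lemma same_mem P S i j : partition P S -> same P i j ->
  (i \in S) && (j \in S).
Proof.
move=> pP /sameP[B [BP iB jB]]; have /subsetP sB := partitionS pP BP.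
by rewrite !sB.
Qed.

Lemma eq_same P Q S : partition P S -> partition Q S -> same P =2 same Q ->
  P = Q.
Proof.
suff half P' Q' : partition P' S -> partition Q' S -> same P' =2 same Q' ->
    P' \subset Q'.
  by move=> pP pQ e; apply/eqP; rewrite eqEsubset !half // => i j.
move=> pP pQ e; apply/subsetP => B BP.
have [i iB] := partition_block_mem pP BP.
have : same Q' i i by rewrite -e; apply/sameP; exists B.
case/sameP=> C [CQ iC _]; suff -> : B = C by [].
apply/setP => j.
rewrite -(same_block _ (partition_trivIset pP) BP iB) e.
by rewrite (same_block _ (partition_trivIset pQ) CQ iC).
Qed.

Lemma eqpartP R S : {in S, forall i, R i i} -> symmetric R -> transitive R ->
  partition (equivalence_partition R S) S.
Proof.
move=> rR sR tR; apply: equivalence_partitionP => i j k _ _ kS.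
split=> [|ij]; first exact: rR.
by apply/idP/idP; apply: tR; rewrite // sR.
Qed.

Lemma same_eqpart R S i j : {in S, forall i, R i i} ->
  symmetric R -> transitive R ->
  same (equivalence_partition R S) i j = [&& i \in S, j \in S & R i j].
Proof.
move=> rR sR tR; apply/sameP/and3P => [[B []]|[iS jS ij]].
  case/imsetP => k kS ->; rewrite !inE => /andP[-> ki] /andP[-> kj].
  by split=> //; apply: tR kj; rewrite sR.
exists [set k in S | R i k]; split; rewrite ?inE ?iS ?jS ?rR //=.
by apply/imsetP; exists i.
Qed.

Lemma noncrossing_same P : trivIset P ->
  reflect (nc_rel (same P)) (noncrossing P).
Proof.
move=> tP; apply: (iffP (noncrossingP _)) => [h a b c d ab bc cd|h B C BP CP].
  move=> /sameP[B [BP aB cB]] /sameP[C [CP bC dC]].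
  by apply/sameP; exists B; rewrite {3}(h B C BP CP a b c d).
move=> a b c d ab bc cd aB bC cB dC.
have : same P a b.
  by apply: h ab bc cd _ _; apply/sameP; [exists B|exists C].
rewrite (same_block _ tP BP aB) => bB.
by rewrite -(def_pblock tP BP bB) (def_pblock tP CP bC).
Qed.

Lemma kr_rel_same P i j : kr_rel P i j = krel (same P) i j.
Proof.
apply/kr_relP/krelP => [h a b /sameP[B [BP aB bB]]|h B a b BP aB bB].
  exact: h BP aB bB.
by apply: h; apply/sameP; exists B.
Qed.

Definition refines P T := [forall B in P, exists C in T, B \subset C].

Lemma refinesP P T S : partition P S -> trivIset T ->
  reflect (subrel (same P) (same T)) (refines P T).
Proof.
move=> pP tT; apply: (iffP forall_inP) => [h i j /sameP[B [BP iB jB]]|h B BP].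
  have /exists_inP[C CT /subsetP BC] := h B BP.
  by apply/sameP; exists C; rewrite !BC.
have [i iB] := partition_block_mem pP BP.
have /h/sameP[C [CT iC _]] : same P i i by apply/sameP; exists B.
apply/exists_inP; exists C => //; apply/subsetP => j jB.
by rewrite -(same_block _ tT CT iC); apply: h; apply/sameP; exists B.
Qed.

(** Keeping [S] a subset of the fixed type of indices lets a block be partitioned in turn without
    renumbering. *)
Definition ncpart S := [set P | partition P S && noncrossing P].

Lemma ncpartP P S :
  reflect (partition P S /\ nc_rel (same P)) (P \in ncpart S).
Proof.
rewrite inE; apply: (iffP andP) => -[pP nP]; split=> //;
  exact/(noncrossing_same (partition_trivIset pP)).
Qed.

Lemma eqpart_ncpart R S : {in S, forall i, R i i} ->
  symmetric R -> transitive R -> nc_rel R ->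
  equivalence_partition R S \in ncpart S.
Proof.
move=> rR sR tR nR; apply/ncpartP; split; first exact: eqpartP.
move=> a b c d ab bc cd; rewrite !same_eqpart //.
by move=> /and3P[-> _ ac] /and3P[-> _ bd]; apply: nR ac bd.
Qed.

Definition krS S P := equivalence_partition (krel (same P)) S.

Definition joinS S P Q := equivalence_partition (jrel (same P) (same Q)) S.

(* The meet of T and [krS S P]. *)
Definition rel_krS S P T :=
  equivalence_partition (fun i j => same T i j && krel (same P) i j) S.

Definition restr P V := [set B in P | B \subset V].

Lemma rel_krS_PER P T : trivIset T ->
  symmetric (fun i j => same T i j && krel (same P) i j) /\
  transitive (fun i j => same T i j && krel (same P) i j).
Proof.
move=> tT; split=> [i j|j i k]; first by rewrite same_sym krel_sym.
move=> /andP[ij ij'] /andP[jk jk'].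
by rewrite (same_trans tT ij jk) (krel_trans ij' jk').
Qed.

Lemma same_krS S P i j :
  same (krS S P) i j = [&& i \in S, j \in S & krel (same P) i j].
Proof.
apply: same_eqpart; first by move=> k _; apply: krel_refl.
  exact: krel_sym.
exact: krel_trans.
Qed.

Lemma krS_ncpart S P : krS S P \in ncpart S.
Proof.
apply: eqpart_ncpart; first by move=> k _; apply: krel_refl.
- exact: krel_sym.
- exact: krel_trans.
- exact: krel_nc.
Qed.

Lemma same_joinS S P Q i j : same (joinS S P Q) i j =
  [&& i \in S, j \in S & jrel (same P) (same Q) i j].
Proof.
apply: same_eqpart; first by move=> k _; apply: jrel_refl.
  exact: jrel_sym.
exact: jrel_trans.
Qed.

Lemma joinS_ncpart S P Q : joinS S P Q \in ncpart S.
Proof.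
apply: eqpart_ncpart; first by move=> k _; apply: jrel_refl.
- exact: jrel_sym.
- exact: jrel_trans.
- exact: jrel_nc.
Qed.

Lemma same_rel_krS S P T i j : partition T S ->
  same (rel_krS S P T) i j = same T i j && krel (same P) i j.
Proof.
move=> pT; have [sR tR] := rel_krS_PER P (partition_trivIset pT).
rewrite same_eqpart // => [|k kS].
  2: by rewrite (same_cover _ pT) kS krel_refl.
have [ij|//] := boolP (same T i j); last by rewrite !andbF.
by have /andP[-> ->] := same_mem pT ij.
Qed.

Lemma rel_krS_ncpart S P T : T \in ncpart S -> rel_krS S P T \in ncpart S.
Proof.
move=> /ncpartP[pT nT]; have [sR tR] := rel_krS_PER P (partition_trivIset pT).
apply: eqpart_ncpart => //.
  by move=> k kS; rewrite (same_cover _ pT) kS krel_refl.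
move=> a b c d ab bc cd /andP[ac ac'] /andP[bd bd'].
by rewrite (nT a b c d) // (krel_nc ab bc cd).
Qed.

Lemma ncpart_partition P S : P \in ncpart S -> partition P S.
Proof. by case/ncpartP. Qed.

Lemma ncpart_trivIset P S : P \in ncpart S -> trivIset P.
Proof. by move/ncpart_partition/partition_trivIset. Qed.

(** An interval saturated for T is saturated for both P and T /\ Kr P, so [krel_separates] gives one
    inclusion; [sub_jrel_meet] is the other. *)
Lemma joinS_rel_krS S P T : P \in ncpart S -> T \in ncpart S -> refines P T ->
  joinS S P (rel_krS S P T) = T.
Proof.
move=> PN TN PT; have pT := ncpart_partition TN; have tT := ncpart_trivIset TN.
have pP := ncpart_partition PN; have tP := ncpart_trivIset PN.
have [_ nP] := ncpartP _ _ PN; have [_ nT] := ncpartP _ _ TN.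
have {}PT := refinesP pP tT PT.
apply: (eq_same _ pT); first exact/ncpart_partition/joinS_ncpart.
have eR : same (rel_krS S P T) =
    (fun i j => same T i j && krel (same P) i j).
  by apply/funext => i; apply/funext => j; rewrite same_rel_krS.
move=> i j; rewrite same_joinS eR; apply/and3P/idP => [[iS jS]|tij].
  move=> /jrelP h; apply: krel_separates nT _ _ _ => //.
  - exact: same_sym.
  - exact: same_trans.
  - by rewrite (same_cover _ pT).
  - by rewrite (same_cover _ pT).
  move=> r s k; apply: h; apply: krel_sub k => // a b /andP[]//.
have /andP[iS jS] := same_mem pT tij; split=> //.
apply: sub_jrel_meet => //; try exact: same_sym; try exact: same_trans.
by move=> k; rewrite (same_cover _ pT) (same_cover _ pP).
Qed.

(** One inclusion is [meet_krel_sub]; the other holds as Q lies below both Kr P and the join. *)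
Lemma rel_krS_joinS S P Q : P \in ncpart S -> Q \in ncpart S ->
  refines Q (krS S P) -> rel_krS S P (joinS S P Q) = Q.
Proof.
move=> PN QN QK; have pQ := ncpart_partition QN.
have tQ := ncpart_trivIset QN.
have {}QK := refinesP pQ (ncpart_trivIset (krS_ncpart S P)) QK.
have [_ nQ] := ncpartP _ _ QN.
have JN := joinS_ncpart S P Q.
apply: (eq_same _ pQ); first exact/ncpart_partition/rel_krS_ncpart.
have sub : subrel (same Q) (krel (same P)).
  by move=> i j /QK; rewrite same_krS => /and3P[].
move=> i j; rewrite same_rel_krS ?same_joinS; last exact: ncpart_partition JN.
apply/andP/idP => [[/and3P[iS jS ij] kij]|qij].
  apply: meet_krel_sub sub _ _ kij ij => //; try exact: same_sym.
  - exact: same_trans.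
  - by rewrite (same_cover _ pQ).
  - by rewrite (same_cover _ pQ).
have /andP[-> ->] := same_mem pQ qij; split; last exact: sub.
by apply/jrelP => r s _ /krelP; apply.
Qed.

Lemma refines_joinS S P Q : P \in ncpart S -> refines P (joinS S P Q).
Proof.
move=> PN; have pP := ncpart_partition PN.
apply/(refinesP pP (ncpart_trivIset (joinS_ncpart S P Q))) => i j ij.
have /andP[iS jS] := same_mem pP ij; rewrite same_joinS iS jS.
by apply/jrelP => r s /krelP + _; apply.
Qed.

Lemma refines_rel_krS S P T : T \in ncpart S ->
  refines (rel_krS S P T) (krS S P).
Proof.
move=> TN; have pT := ncpart_partition TN.
have RN := rel_krS_ncpart P TN.
apply/(refinesP (ncpart_partition RN) (ncpart_trivIset (krS_ncpart S P))).
move=> i j; rewrite same_rel_krS // same_krS => /andP[ij ->].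
by have /andP[-> ->] := same_mem pT ij.
Qed.

Lemma reindex_rel_krS (M : nmodType) S P (F : {set {set 'I_n}} -> M) :
  P \in ncpart S ->
  \sum_(Q in ncpart S | refines Q (krS S P)) F Q =
  \sum_(T in ncpart S | refines P T) F (rel_krS S P T).
Proof.
move=> PN; rewrite (reindex_onto (rel_krS S P) (joinS S P)) /=; last first.
  by move=> Q /andP[QN QK]; apply: rel_krS_joinS.
apply: eq_bigl => T; apply/andP/andP => [[_ /eqP <-]|[TN PT]].
  by rewrite joinS_ncpart refines_joinS.
by rewrite rel_krS_ncpart // refines_rel_krS // joinS_rel_krS.
Qed.

(** * Restricting a partition to the blocks of a coarser one *)

Section Restriction.
Variables (S : {set 'I_n}) (P T : {set {set 'I_n}}).
Hypotheses (PN : P \in ncpart S) (TN : T \in ncpart S) (PT : refines P T).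

Let pP := ncpart_partition PN.
Let pT := ncpart_partition TN.
Let tP := ncpart_trivIset PN.
Let tT := ncpart_trivIset TN.

Lemma same_restr V i j : V \in T -> i \in V ->
  same (restr P V) i j = same P i j.
Proof.
move=> VT iV; apply/sameP/sameP => -[B [BP iB jB]]; exists B; split=> //.
  by move: BP; rewrite inE => /andP[].
rewrite inE BP; apply/subsetP => k kB.
rewrite -(same_block _ tT VT iV); apply: (refinesP pP tT PT).
by apply/sameP; exists B.
Qed.

Lemma restr_partition V : V \in T -> partition (restr P V) V.
Proof.
move=> VT; apply/and3P; split.
- apply/eqP/setP => i; apply/bigcupP/idP => [[B]|iV].
    by rewrite inE => /andP[_ /subsetP]; apply.
  have /sameP[B [BR iB _]] : same (restr P V) i i.
    rewrite same_restr // (same_cover _ pP).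
    by apply: subsetP iV; apply: partitionS pT VT.
  by exists B.
- by apply: trivIsetS tP; apply/subsetP => B; rewrite inE => /andP[].
- by rewrite inE; case/and3P: pP => _ _ /negPf ->.
Qed.

Lemma restr_ncpart V : V \in T -> restr P V \in ncpart V.
Proof.
move=> VT; rewrite inE restr_partition //=.
have /andP[_ /noncrossingP nP] : partition P S && noncrossing P.
  by move: PN; rewrite inE.
apply/noncrossingP => B C; rewrite !inE => /andP[BP _] /andP[CP _].
exact: nP.
Qed.

Lemma block_sub_unique B V W : B \in P -> V \in T -> W \in T ->
  B \subset V -> B \subset W -> V = W.
Proof.
move=> BP VT WT /subsetP BV /subsetP BW.
have [i iB] := partition_block_mem pP BP.
by rewrite -(def_pblock tT VT (BV i iB)) (def_pblock tT WT (BW i iB)).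
Qed.

Lemma bigcup_restr : \bigcup_(V in T) restr P V = P.
Proof.
apply/setP => B; apply/bigcupP/idP => [[V _]|BP].
  by rewrite inE => /andP[].
have /exists_inP[V VT BV] := forall_inP PT B BP.
by exists V; rewrite // inE BP.
Qed.

Lemma prod_restr (K : comPzRingType) (k : {set 'I_n} -> K) :
  \prod_(V in T) \prod_(B in restr P V) k B = \prod_(B in P) k B.
Proof.
(* The block of T that contains B; the default [set0] is never a block of T. *)
pose p B := odflt set0 [pick V in T | B \subset V].
have pE B V : B \in P -> V \in T -> (p B == V) = (B \subset V).
  move=> BP VT; rewrite /p; case: pickP => [W /andP[WT BW]|/(_ V)] /=.
    apply/eqP/idP => [<- //|BV]; exact: block_sub_unique BP WT VT BW BV.
  rewrite VT /= => ->.
  by apply/eqP => V0; case: (partition_block_mem pT VT) => i; rewrite -V0 inE.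
rewrite [RHS](partition_big p (mem T)) /= => [|B BP].
  apply: eq_bigr => V VT; apply: eq_bigl => B; rewrite inE.
  by have [BP|//] := boolP (B \in P); rewrite pE.
have /exists_inP[V VT BV] := forall_inP PT B BP.
by have /eqP -> : p B == V by rewrite pE.
Qed.

End Restriction.

(** * Gluing partitions of the blocks *)

Section Union.
Variables (S : {set 'I_n}) (T : {set {set 'I_n}}).
Variable f : {set 'I_n} -> {set {set 'I_n}}.
Hypotheses (TN : T \in ncpart S) (fN : forall V, V \in T -> f V \in ncpart V).

Let U := \bigcup_(V in T) f V.
Let pT := ncpart_partition TN.
Let tT := ncpart_trivIset TN.

Lemma bigcup_ncpart : U \in ncpart S.
Proof.
have nT : noncrossing T by move: TN; rewrite inE => /andP[].
rewrite inE; apply/andP; split; last first.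
  apply/noncrossingP => B C /bigcupP[V VT BV] /bigcupP[W WT CW].
  move=> a b c d ab bc cd aB bC cB dC.
  have /subsetP sV := partitionS (ncpart_partition (fN VT)) BV.
  have /subsetP sW := partitionS (ncpart_partition (fN WT)) CW.
  have e : V = W.
    apply: (noncrossingP _ nT _ _ VT WT a b c d) => //; [exact: sV|exact: sW
      |exact: sV|exact: sW].
  subst W; have := fN VT; rewrite inE => /andP[_ /noncrossingP nV].
  exact: (nV B C BV CW a b c d).
apply/and3P; split.
- apply/eqP/setP => i; apply/bigcupP/idP => [[B /bigcupP[V VT BV] iB]|iS].
    have /subsetP sV := partitionS (ncpart_partition (fN VT)) BV.
    by move/subsetP: (partitionS pT VT); apply; apply: sV.
  have /sameP[V [VT iV _]] : same T i i by rewrite (same_cover _ pT).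
  have := iV; rewrite -(same_cover _ (ncpart_partition (fN VT))).
  case/sameP => B [BV iB _]; exists B => //; by apply/bigcupP; exists V.
- apply/trivIsetP => B C /bigcupP[V VT BV] /bigcupP[W WT CW] nBC.
  have [e|nVW] := eqVneq V W.
    subst W; by move/trivIsetP: (ncpart_trivIset (fN VT)); apply.
  have sV := partitionS (ncpart_partition (fN VT)) BV.
  have sW := partitionS (ncpart_partition (fN WT)) CW.
  apply: disjointWl sV _; apply: disjointWr sW _.
  by move/trivIsetP: tT; apply.
- apply/bigcupP => -[V VT V0].
  by case/and3P: (ncpart_partition (fN VT)) => _ _; rewrite V0.
Qed.

Lemma refines_bigcup : refines U T.
Proof.
apply/forall_inP => B /bigcupP[V VT BV]; apply/exists_inP; exists V => //.
exact: partitionS (ncpart_partition (fN VT)) BV.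
Qed.

Lemma restr_bigcup V : V \in T -> restr U V = f V.
Proof.
move=> VT; apply/setP => B; rewrite inE; apply/andP/idP => [[BU BV]|BV].
  have /bigcupP[W WT BW] := BU.
  have sW := partitionS (ncpart_partition (fN WT)) BW.
  by rewrite (block_sub_unique bigcup_ncpart TN BU VT WT).
split; last exact: partitionS (ncpart_partition (fN VT)) BV.
by apply/bigcupP; exists V.
Qed.

End Union.

(** Distributivity: choosing a noncrossing partition of each block of T amounts to choosing one
    noncrossing partition finer than T. *)
Lemma prod_sum_ncpart (K : comPzRingType) S T
    (g : {set 'I_n} -> {set {set 'I_n}} -> K) : T \in ncpart S ->
  \prod_(V in T) \sum_(P in ncpart V) g V P =
  \sum_(P in ncpart S | refines P T) \prod_(V in T) g V (restr P V).
Proof.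
move=> TN; rewrite (big_distr_big_dep set0).
pose h (f : {ffun {set 'I_n} -> {set {set 'I_n}}}) := \bigcup_(V in T) f V.
(* The value [set0] off T is the default that [pfamily] imposes. *)
pose h' P : {ffun {set 'I_n} -> {set {set 'I_n}}} :=
  [ffun V => if V \in T then restr P V else set0].
rewrite [RHS](reindex_onto h h') /=; last first.
  move=> P /andP[PN PT]; rewrite -[RHS](bigcup_restr PT).
  by apply: eq_bigr => V VT; rewrite ffunE VT.
have fam f : reflect ((h f \in ncpart S) && refines (h f) T /\ h' (h f) = f)
    (f \in pfamily set0 (fun V => V \in T) (fun V P => P \in ncpart V)).
  apply: (iffP pfamilyP) => [[/subsetP s0 fN]|[/andP[hN hT] <-]].
    rewrite bigcup_ncpart // refines_bigcup //; split=> //.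
    apply/ffunP => V; rewrite ffunE; case: ifP => VT.
      exact: restr_bigcup TN fN _ VT.
    by apply/esym/eqP/negPn/negP => /s0; rewrite VT.
  split.
    by apply/subsetP => V; rewrite !inE ffunE; case: ifP; rewrite ?eqxx.
  by move=> V VT; rewrite ffunE VT; apply: restr_ncpart TN hT _ VT.
apply: eq_big => [f|f /fam[_ e]].
  by apply/fam/andP => -[? /eqP].
by apply: eq_bigr => V VT; rewrite -{1}e ffunE VT.
Qed.

(** T /\ Kr P is the relative Kreweras complement of P in T, which is formed block by block. *)
Lemma krS_restr S P T V : P \in ncpart S -> T \in ncpart S -> refines P T ->
  V \in T -> krS V (restr P V) = restr (rel_krS S P T) V.
Proof.
move=> PN TN PT VT; have pT := ncpart_partition TN.
have tT := ncpart_trivIset TN; have [_ nT] := ncpartP _ _ TN.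
have RN := rel_krS_ncpart P TN.
have RT : refines (rel_krS S P T) T.
  apply/(refinesP (ncpart_partition RN) tT) => i j.
  by rewrite same_rel_krS // => /andP[].
have pR := restr_partition RN TN RT VT.
apply: (eq_same _ pR); first exact/ncpart_partition/krS_ncpart.
move=> i j; rewrite same_krS.
have [iV|niV] := boolP (i \in V); last first.
  by apply/esym/negbTE/negP => /(same_mem pR)/andP[iV]; rewrite iV in niV.
rewrite (same_restr _ TN RT) // same_rel_krS // (same_block _ tT VT iV) /=.
have [jV /=|//] := boolP (j \in V).
have tij : same T i j by rewrite (same_block _ tT VT iV).
have sPT := refinesP (ncpart_partition PN) tT PT.
rewrite -(krel_restrict (same_sym P) sPT (same_sym T) (same_trans tT) nT tij).
congr (krel _ i j); apply/funext => a; apply/funext => b.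
rewrite (same_block _ tT VT iV).
have [aV|naV] := boolP (a \in V); first by rewrite (same_restr PN TN PT) ?andbT.
rewrite andbF; apply/negbTE/negP.
move=> /(same_mem (restr_partition PN TN PT VT)) /andP[aV].
by rewrite aV in naV.
Qed.

(** Substitute Q = T /\ Kr P, exchange the sums over P and T, and factor both products over the
    blocks of T. *)
Lemma sum_boxed (K : comPzRingType) S (k l : {set 'I_n} -> K) :
  \sum_(P in ncpart S) \sum_(Q in ncpart S | refines Q (krS S P))
     (\prod_(B in P) k B) * (\prod_(B in Q) l B) =
  \sum_(T in ncpart S) \prod_(V in T) \sum_(P in ncpart V)
     (\prod_(B in P) k B) * (\prod_(B in krS V P) l B).
Proof.
under eq_bigr => P PN do rewrite (reindex_rel_krS _ PN).
rewrite (exchange_big_dep (mem (ncpart S))) /=; last by move=> P T _ /andP[].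
apply: eq_bigr => T TN; rewrite (prod_sum_ncpart _ TN).
apply: eq_big => [P|P /andP[PN /andP[_ PT]]]; first by rewrite TN.
rewrite big_split /= (prod_restr PN TN PT); congr (_ * _).
have RN := rel_krS_ncpart P TN.
have RT : refines (rel_krS S P T) T.
  apply/(refinesP (ncpart_partition RN) (ncpart_trivIset TN)) => i j.
  by rewrite (same_rel_krS _ _ _ (ncpart_partition TN)) => /andP[].
rewrite -(prod_restr RN TN RT); apply: eq_bigr => V VT.
by rewrite (krS_restr PN TN PT VT).
Qed.

End PartitionRelations.

(** * Relabelling and interleaving *)

Lemma mk_partition n (P : {set {set 'I_n}}) (S : {set 'I_n}) :
  (forall B i, B \in P -> i \in B -> i \in S) ->
  (forall i, i \in S -> exists2 B, B \in P & i \in B) ->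
  (forall B C i, B \in P -> C \in P -> i \in B -> i \in C -> B = C) ->
  set0 \notin P -> partition P S.
Proof.
move=> PS SP tP P0; apply/and3P; split=> //.
  apply/eqP/setP => i; apply/bigcupP/idP => [[B]|/SP[B]]; first exact: PS.
  by exists B.
apply/trivIsetP => B C BP CP; apply: contraR => /pred0Pn[i /andP[iB iC]].
exact/eqP/(tP _ _ i).
Qed.

Lemma partition_block_eq n (P : {set {set 'I_n}}) S B C i : partition P S ->
  B \in P -> C \in P -> i \in B -> i \in C -> B = C.
Proof.
move=> /partition_trivIset tP BP CP iB iC.
by rewrite -(def_pblock tP BP iB) (def_pblock tP CP iC).
Qed.

Lemma partition_cover_mem n (P : {set {set 'I_n}}) S i : partition P S ->
  i \in S -> exists2 B, B \in P & i \in B.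
Proof. by move=> /cover_partition <- /bigcupP[B]; exists B. Qed.

Lemma partition_block_proper n (P : {set {set 'I_n}}) S V : partition P S ->
  P != [set S] -> V \in P -> V \proper S.
Proof.
move=> pP nP VP; rewrite properEneq (partitionS pP VP) andbT.
apply: contraNneq nP => VS; apply/eqP/setP => B; rewrite inE.
apply/idP/eqP => [BP|->]; last by rewrite -VS.
have [j jB] := partition_block_mem pP BP.
rewrite -VS; apply: (partition_block_eq pP BP VP jB).
by rewrite VS; apply: subsetP (partitionS pP BP) _ jB.
Qed.

Lemma set1_ncpart n (S : {set 'I_n}) : S != set0 -> [set S] \in ncpart S.
Proof.
move=> S0; rewrite inE; apply/andP; split.
  apply: mk_partition.
  - by move=> B i; rewrite inE => /eqP ->.
  - by move=> i iS; exists S; rewrite ?inE.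
  - by move=> B C i; rewrite !inE => /eqP -> /eqP ->.
  - by rewrite inE eq_sym.
by apply/noncrossingP => B C; rewrite !inE => /eqP -> /eqP ->.
Qed.

Lemma sorted_enum_ord n (V : {set 'I_n}) :
  sorted (fun i j : 'I_n => i < j)%N (enum V).
Proof.
rewrite /enum_mem; apply: sorted_filter => [a b c|]; first exact: ltn_trans.
by have := iota_ltn_sorted 0 n; rewrite -val_enum_ord sorted_map enumT.
Qed.

Lemma imset_preim_codom m n (f : 'I_n -> 'I_m) (B : {set 'I_m}) :
  B \subset codom f -> f @: (f @^-1: B) = B.
Proof.
move=> /subsetP Bf; apply/setP => k; apply/imsetP/idP => [[j]|kB].
  by rewrite inE => jB ->.
by have /codomP[j e] := Bf _ kB; exists j; rewrite // inE -e.
Qed.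

(** * Transport along strictly increasing maps *)

Section Transport.
Variables (m n : nat) (f : 'I_m -> 'I_n).
Hypothesis f_lt : forall i j, (f i < f j)%N = (i < j)%N.
Implicit Types (P : {set {set 'I_m}}) (Q : {set {set 'I_n}}) (S : {set 'I_m}).

Lemma lt_mono_inj : injective f.
Proof.
move=> i j e; apply: val_inj; have := f_lt i j; have := f_lt j i.
by rewrite e ltnn => /esym/negbT + /esym/negbT /=; lia.
Qed.
Let fI := lt_mono_inj.

Definition push P : {set {set 'I_n}} := [set f @: (B : {set 'I_m}) | B in P].
Definition pull Q : {set {set 'I_m}} := [set f @^-1: (B : {set 'I_n}) | B in Q].

Lemma preim_imset (B : {set 'I_m}) : f @^-1: (f @: B) = B.
Proof. by apply/setP => i; rewrite inE mem_imset. Qed.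

Lemma imset_preim S (B : {set 'I_n}) : B \subset f @: S -> f @: (f @^-1: B) = B.
Proof.
move=> /subsetP BS; apply/imset_preim_codom/subsetP => k /BS/imsetP[j _ ->].
exact: codom_f.
Qed.

Lemma pushK : cancel push pull.
Proof.
move=> P; rewrite /pull /push -imset_comp -[RHS]imset_id.
by apply: eq_imset => B; apply: preim_imset.
Qed.

Lemma pullK S Q : partition Q (f @: S) -> push (pull Q) = Q.
Proof.
move=> pQ; rewrite /pull /push -imset_comp -[RHS]imset_id.
by apply: eq_in_imset => B BQ; apply: imset_preim (partitionS pQ BQ).
Qed.

Lemma push_ncpart S P : P \in ncpart S -> push P \in ncpart (f @: S).
Proof.
rewrite !inE => /andP[pP /noncrossingP nP]; apply/andP; split.
  apply: mk_partition.
  - move=> _ i /imsetP[B BP ->] /imsetP[j jB ->]; apply: imset_f.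
    exact: subsetP (partitionS pP BP) j jB.
  - move=> _ /imsetP[i iS ->]; have [B BP iB] := partition_cover_mem pP iS.
    by exists (f @: B); apply: imset_f.
  - move=> _ _ k /imsetP[B BP ->] /imsetP[C CP ->] /imsetP[i iB ->].
    by rewrite mem_imset // => iC; rewrite (partition_block_eq pP BP CP iB iC).
  - apply/imsetP => -[B BP e]; have [i iB] := partition_block_mem pP BP.
    by have : f i \in set0 by [rewrite e imset_f]; rewrite inE.
apply/noncrossingP => _ _ /imsetP[B BP ->] /imsetP[C CP ->] a b c d.
move=> ab bc cd /imsetP[a' aB ea] /imsetP[b' bC eb] /imsetP[c' cB ec].
move=> /imsetP[d' dC ed]; move: ab bc cd.
rewrite ea eb ec ed !f_lt => ab bc cd.
by rewrite (nP B C BP CP a' b' c' d').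
Qed.

Lemma pull_ncpart S Q : Q \in ncpart (f @: S) -> pull Q \in ncpart S.
Proof.
rewrite !inE => /andP[pQ /noncrossingP nQ]; apply/andP; split.
  apply: mk_partition.
  - move=> _ i /imsetP[B BQ ->]; rewrite inE => iB.
    by have := subsetP (partitionS pQ BQ) _ iB; rewrite mem_imset.
  - move=> i iS; have [B BQ iB] := partition_cover_mem pQ (imset_f f iS).
    by exists (f @^-1: B); rewrite ?inE //; apply: imset_f.
  - move=> _ _ i /imsetP[B BQ ->] /imsetP[C CQ ->]; rewrite !inE => iB iC.
    by rewrite (partition_block_eq pQ BQ CQ iB iC).
  - apply/imsetP => -[B BQ e]; have [k kB] := partition_block_mem pQ BQ.
    have /imsetP[i _ ki] := subsetP (partitionS pQ BQ) _ kB.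
    by have : i \in set0 by [rewrite e inE -ki]; rewrite inE.
apply/noncrossingP => _ _ /imsetP[B BQ ->] /imsetP[C CQ ->] a b c d.
rewrite !inE => ab bc cd aB bC cB dC.
by rewrite (nQ B C BQ CQ (f a) (f b) (f c) (f d)) ?f_lt.
Qed.

Lemma sum_push (M : nmodType) S (F : {set {set 'I_n}} -> M) :
  \sum_(Q in ncpart (f @: S)) F Q = \sum_(P in ncpart S) F (push P).
Proof.
rewrite (reindex_onto push pull) /= => [|Q QN]; last first.
  exact: pullK (ncpart_partition QN).
apply: eq_bigl => P; rewrite pushK eqxx andbT; apply/idP/idP.
  by move/pull_ncpart; rewrite pushK.
exact: push_ncpart.
Qed.

Lemma prod_push (K : comPzRingType) P (k : {set 'I_n} -> K) :
  \prod_(V in push P) k V = \prod_(V in P) k (f @: V).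
Proof. by rewrite big_imset //= => B C _ _; apply: imset_inj. Qed.

Lemma enum_imset (V : {set 'I_m}) : enum (f @: V) = map f (enum V).
Proof.
apply: (@irr_sorted_eq _ (fun i j : 'I_n => i < j)%N).
- by move=> a b c; apply: ltn_trans.
- by move=> a; apply: ltnn.
- exact: sorted_enum_ord.
- rewrite sorted_map; apply: sub_sorted (sorted_enum_ord V) => i j /=.
  by rewrite f_lt.
move=> k; rewrite mem_enum; apply/imsetP/mapP => -[i iV ->]; exists i => //.
  by rewrite mem_enum.
by rewrite mem_enum in iV.
Qed.

End Transport.

(** * Interleaving two partitions *)

Section Interleave.
Variable n : nat.
Implicit Types (P Q : {set {set 'I_n}}) (S : {set 'I_n}).
Implicit Types (R : {set {set 'I_n.*2}}).

Lemma plain_or_barred (k : 'I_n.*2) :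
  (exists i, k = plain i) \/ (exists i, k = barred i).
Proof.
have hn : (k./2 < n)%N by have := ltn_ord k; lia.
have := odd_double_half k; case: (odd k) => /= e.
  by right; exists (Ordinal hn); apply: val_inj => /=; lia.
by left; exists (Ordinal hn); apply: val_inj => /=; lia.
Qed.

Lemma plain_inj : injective (@plain n).
Proof. by move=> i j /(congr1 val) /= e; apply: val_inj => /=; lia. Qed.

Lemma barred_inj : injective (@barred n).
Proof. by move=> i j /(congr1 val) /= e; apply: val_inj => /=; lia. Qed.

Lemma plain_neq_barred i j : plain i <> barred j :> 'I_n.*2.
Proof. by move/(congr1 (odd \o val)) => /=; lia. Qed.

Definition plain_barred S : {set 'I_n.*2} :=
  (@plain n @: S) :|: (@barred n @: S).

Lemma plain_in S i : (plain i \in plain_barred S) = (i \in S).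
Proof.
rewrite inE (mem_imset _ _ plain_inj).
case: imsetP => [[j _ /plain_neq_barred]|] //; by rewrite orbF.
Qed.

Lemma barred_in S i : (barred i \in plain_barred S) = (i \in S).
Proof.
rewrite inE (mem_imset _ _ barred_inj).
by case: imsetP => [[j _ /esym/plain_neq_barred]|].
Qed.

Lemma interleaveP P Q B : reflect
  ((exists2 C, C \in P & B = @plain n @: C) \/
   (exists2 C, C \in Q & B = @barred n @: C))
  (B \in interleave P Q).
Proof.
rewrite inE; apply: (iffP orP) => [[]/imsetP[C CP ->]|[][C CP ->]].
- by left; exists C.
- by right; exists C.
- by left; apply: imset_f.
- by right; apply: imset_f.
Qed.

Definition monochrome (B : {set 'I_n.*2}) :=
  (B \subset codom (@plain n)) || (B \subset codom (@barred n)).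

Lemma same_interleave P Q :
  [/\ forall i j, same (interleave P Q) (plain i) (plain j) = same P i j,
      forall i j, same (interleave P Q) (barred i) (barred j) = same Q i j,
      forall i j, same (interleave P Q) (plain i) (barred j) = false &
      forall i j, same (interleave P Q) (barred i) (plain j) = false].
Proof.
have c1 i j : same (interleave P Q) (plain i) (barred j) = false.
  apply/negbTE/negP => /sameP[_ [/interleaveP[] [C _ ->]]].
    by move=> _ /imsetP[k _ /esym/plain_neq_barred].
  by move=> /imsetP[k _ /plain_neq_barred].
split=> //; last by move=> i j; rewrite same_sym.
- move=> i j.
  apply/sameP/sameP => [[_ [/interleaveP[] [C CP ->]]]|[B [BP iB jB]]].
  + rewrite !(mem_imset _ _ plain_inj) => iC jC; exists C; split=> //.
  + by move=> /imsetP[k _ /plain_neq_barred].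
  exists (@plain n @: B); rewrite !imset_f //; split=> //.
  by apply/interleaveP; left; exists B.
- move=> i j.
  apply/sameP/sameP => [[_ [/interleaveP[] [C CP ->]]]|[B [BP iB jB]]].
  + by move=> /imsetP[k _ /esym/plain_neq_barred].
  + rewrite !(mem_imset _ _ barred_inj) => iC jC; exists C; split=> //.
  exists (@barred n @: B); rewrite !imset_f //; split=> //.
  by apply/interleaveP; right; exists B.
Qed.

Lemma interleave_partition S P Q : partition P S -> partition Q S ->
  partition (interleave P Q) (plain_barred S).
Proof.
move=> pP pQ; apply: mk_partition.
- move=> B k /interleaveP[][C CP ->] /imsetP[i iC ->].
    by rewrite plain_in; apply: subsetP (partitionS pP CP) i iC.
  by rewrite barred_in; apply: subsetP (partitionS pQ CP) i iC.
- move=> k; have [[i ->]|[i ->]] := plain_or_barred k.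
    rewrite plain_in => /(partition_cover_mem pP)[B BP iB].
    by exists (@plain n @: B); rewrite ?imset_f //;
      apply/interleaveP; left; exists B.
  rewrite barred_in => /(partition_cover_mem pQ)[B BP iB].
  by exists (@barred n @: B); rewrite ?imset_f //;
    apply/interleaveP; right; exists B.
- move=> B C k /interleaveP[][B' BP ->] /interleaveP[][C' CP ->].
  + move=> /imsetP[i iB ->]; rewrite (mem_imset _ _ plain_inj) => iC.
    by rewrite (partition_block_eq pP BP CP iB iC).
  + by move=> /imsetP[i iB ->] /imsetP[j _ /plain_neq_barred].
  + by move=> /imsetP[i iB ->] /imsetP[j _ /esym/plain_neq_barred].
  + move=> /imsetP[i iB ->]; rewrite (mem_imset _ _ barred_inj) => iC.
    by rewrite (partition_block_eq pQ BP CP iB iC).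
- apply/interleaveP => -[][C CP e].
    have [i iC] := partition_block_mem pP CP.
    by have : plain i \in set0 by [rewrite e imset_f]; rewrite inE.
  have [i iC] := partition_block_mem pQ CP.
  by have : barred i \in set0 by [rewrite e imset_f]; rewrite inE.
Qed.

(** A crossing between the two colours would put two elements of one block of P on different sides
    of an interval ]i, j] with i, j in one block of Q, which Q <= Kr P forbids. *)
Lemma interleave_ncpart S P Q : P \in ncpart S -> Q \in ncpart S ->
  refines Q (krS S P) -> interleave P Q \in ncpart (plain_barred S).
Proof.
move=> /ncpartP[pP nP] /ncpartP[pQ nQ] QK.
apply/ncpartP; split; first exact: interleave_partition.
have sub : subrel (same Q) (krel (same P)).
  move=> i j /(refinesP pQ (ncpart_trivIset (krS_ncpart S P)) QK).
  by rewrite same_krS => /and3P[].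
have [sP sQ sPQ sQP] := same_interleave P Q.
move=> a b c d; have [[a' ->]|[a' ->]] := plain_or_barred a;
have [[c' ->]|[c' ->]] := plain_or_barred c;
have [[b' ->]|[b' ->]] := plain_or_barred b;
have [[d' ->]|[d' ->]] := plain_or_barred d; rewrite ?(sP, sQ, sPQ, sQP) //=.
- by rewrite !ltn_double; apply: nP.
- move=> ab bc cd ac /sub/krelP/(_ _ _ ac); rewrite /between; lia.
- move=> ab bc cd /sub/krelP h bd; have := h _ _ bd; rewrite /between; lia.
- by rewrite !ltnS !ltn_double; apply: nQ.
Qed.

Lemma interleave_ncpart_inv S P Q :
  interleave P Q \in ncpart (plain_barred S) ->
  [/\ P \in ncpart S, Q \in ncpart S & refines Q (krS S P)].
Proof.
move=> IN; have [pI nI] := ncpartP _ _ IN.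
have [sP sQ sPQ sQP] := same_interleave P Q.
have nc_I : noncrossing (interleave P Q) by move: IN; rewrite inE => /andP[].
have pP : partition P S.
  apply: mk_partition.
  - move=> B i BP iB; rewrite -plain_in -(same_cover _ pI) sP.
    by apply/sameP; exists B.
  - move=> i; rewrite -plain_in -(same_cover _ pI) sP => /sameP[B [BP iB _]].
    by exists B.
  - move=> B C i BP CP iB iC; apply: (imset_inj plain_inj).
    apply: (partition_block_eq (i := plain i) pI); rewrite ?imset_f //;
      apply/interleaveP; left; first [by exists B|by exists C].
  - apply/negP => P0; have [|i] := partition_block_mem (B := set0) pI.
      by apply/interleaveP; left; exists set0; rewrite ?imset0.
    by rewrite inE.
have pQ : partition Q S.
  apply: mk_partition.
  - move=> B i BP iB; rewrite -barred_in -(same_cover _ pI) sQ.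
    by apply/sameP; exists B.
  - move=> i; rewrite -barred_in -(same_cover _ pI) sQ => /sameP[B [BP iB _]].
    by exists B.
  - move=> B C i BP CP iB iC; apply: (imset_inj barred_inj).
    apply: (partition_block_eq (i := barred i) pI); rewrite ?imset_f //;
      apply/interleaveP; right; first [by exists B|by exists C].
  - apply/negP => P0; have [|i] := partition_block_mem (B := set0) pI.
      by apply/interleaveP; right; exists set0; rewrite ?imset0.
    by rewrite inE.
have QK : refines Q (krS S P).
  apply/(refinesP pQ (ncpart_trivIset (krS_ncpart S P))) => i j ij.
  have /andP[iS jS] := same_mem pQ ij; rewrite same_krS iS jS /=.
  have /sameP[B [BQ iB jB]] := ij.
  by rewrite -kr_rel_same; apply: interleave_kr_rel nc_I BQ iB jB.
split=> //; apply/ncpartP; split=> // a b c d ab bc cd ac bd.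
  by rewrite -sP; apply: (nI _ _ (plain c) (plain d));
    rewrite ?sP //= ltn_double.
by rewrite -sQ; apply: (nI _ _ (barred c) (barred d));
   rewrite ?sQ //= ltnS ltn_double.
Qed.

Lemma mem_interleave S P Q (B : {set 'I_n}) : partition P S -> partition Q S ->
  ((@plain n @: B \in interleave P Q) = (B \in P)) *
  ((@barred n @: B \in interleave P Q) = (B \in Q)).
Proof.
move=> pP pQ; split; apply/interleaveP/idP => [[][C CP e]|BP].
- by rewrite (imset_inj plain_inj e).
- have [k kC] := partition_block_mem pQ CP.
  have : barred k \in @plain n @: B by rewrite e imset_f.
  by case/imsetP => j _ /esym/plain_neq_barred.
- by left; exists B.
- have [k kC] := partition_block_mem pP CP.
  have : plain k \in @barred n @: B by rewrite e imset_f.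
  by case/imsetP => j _ /plain_neq_barred.
- by rewrite (imset_inj barred_inj e).
- by right; exists B.
Qed.

Lemma sum_interleave (M : nmodType) S (F : {set {set 'I_n.*2}} -> M) :
  \sum_(R in ncpart (plain_barred S) | [forall B in R, monochrome B]) F R =
  \sum_(P in ncpart S) \sum_(Q in ncpart S | refines Q (krS S P))
    F (interleave P Q).
Proof.
pose h (PQ : {set {set 'I_n}} * {set {set 'I_n}}) := interleave PQ.1 PQ.2.
(* P and Q are recovered as the plain and the barred blocks; blocks being nonempty, none is of both
   kinds. *)
pose h' (R : {set {set 'I_n.*2}}) :=
  ([set B : {set 'I_n} | @plain n @: B \in R],
   [set B : {set 'I_n} | @barred n @: B \in R]).
rewrite pair_big_dep /= (reindex_onto h h') /=; last first.
  move=> R /andP[RN /forall_inP mR]; apply/setP => B.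
  apply/interleaveP/idP => [[][C]|BR]; try by rewrite inE => CR ->.
  have [BS|BS] := orP (mR B BR); [left|right].
    by exists (@plain n @^-1: B); rewrite ?inE imset_preim_codom.
  by exists (@barred n @^-1: B); rewrite ?inE imset_preim_codom.
apply: eq_bigl => -[P Q] /=; rewrite /h /=; apply/idP/idP.
  by move=> /andP[/andP[/interleave_ncpart_inv[-> -> ->]]].
move=> /andP[PN /andP[QN QK]]; rewrite interleave_ncpart //=.
have pP := ncpart_partition PN; have pQ := ncpart_partition QN.
apply/andP; split.
  apply/forall_inP => _ /interleaveP[][C _ ->]; apply/orP; [left|right];
    by apply/subsetP => _ /imsetP[k _ ->]; apply: codom_f.
by apply/eqP; congr (_, _); apply/setP => B;
  rewrite inE (mem_interleave _ pP pQ).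
Qed.

Lemma prod_interleave (K : comPzRingType) S P Q (k : {set 'I_n.*2} -> K) :
  partition P S -> partition Q S ->
  \prod_(B in interleave P Q) k B =
  (\prod_(B in P) k (@plain n @: B)) * (\prod_(B in Q) k (@barred n @: B)).
Proof.
move=> pP pQ.
transitivity (\prod_(B in [predU [set @plain n @: (C : {set 'I_n}) | C in P]
  & [set @barred n @: (C : {set 'I_n}) | C in Q]]) k B).
  by apply: eq_bigl => B; rewrite !inE.
rewrite bigU; last first.
  apply/pred0Pn => -[B /= /andP[/imsetP[C CP ->] /imsetP[D DQ e]]].
  have [i iC] := partition_block_mem pP CP.
  have : plain i \in @barred n @: D by rewrite -e imset_f.
  by case/imsetP => j _ /plain_neq_barred.
by rewrite !big_imset //= => B C _ _; apply: imset_inj;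
  [apply: barred_inj|apply: plain_inj].
Qed.

End Interleave.

(** * From [NC n] to [ncpart], and the Kreweras map *)

Section SumNC.
Variable n : nat.

Lemma sum_NC (M : nmodType) (F : {set {set 'I_n}} -> M) :
  \sum_(P : NC n) F (val P) = \sum_(P in ncpart [set: 'I_n]) F P.
Proof.
rewrite (reindex_omap (val : NC n -> _) insub) /=; last first.
  by move=> P; rewrite inE => PN; rewrite insubT.
by apply: eq_bigl => P; rewrite valK eqxx andbT inE (valP P).
Qed.

Lemma val_Kr (P : NC n) : val (Kr P) = krS [set: 'I_n] (val P).
Proof.
have KN := krS_ncpart [set: 'I_n] (val P).
have PN : val P \in ncpart [set: 'I_n] by rewrite inE (valP P).
have KP : (krS [set: 'I_n] (val P)) = kr_blocks (val P).
  rewrite /krS /kr_blocks; congr equivalence_partition.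
  by apply/funext => i; apply/funext => j; rewrite kr_rel_same.
have [nc_K /forallP max_K] := andP (KrP P).
move: KN; rewrite inE => KN.
pose Q : NC n := exist _ (krS [set: 'I_n] (val P)) KN.
suff -> : Kr P = Q by [].
apply/le_anti/andP; split.
  have pK : partition (val (Kr P)) [set: 'I_n] by case/andP: (valP (Kr P)).
  apply/(refinesP pK (ncpart_trivIset (krS_ncpart _ _))) => i j.
  move=> /sameP[B [BK iB jB]]; rewrite same_krS !inE -kr_rel_same.
  exact: interleave_kr_rel nc_K BK iB jB.
by apply: (implyP (max_K Q)); rewrite /= KP interleave_nc.
Qed.

End SumNC.

(** * Moments and cumulants *)

Section MoebiusDual.
Variables (d : Order.disp_t) (T : finPOrderType d).

(* The zeta and Moebius matrices are inverse to each other on both sides. *)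
Lemma moebius_sum_dual (x y : T) : (x <= y)%O ->
  \sum_(z | (x <= z)%O && (z <= y)%O) moebius z y = (x == y)%:R.
Proof.
move=> xy; pose e : 'I_#|T| -> T := enum_val.
pose Z : 'M[int]_#|T| := \matrix_(i, j) (e i <= e j)%O%:R.
pose M : 'M[int]_#|T| := \matrix_(i, j)
  if (e i <= e j)%O then moebius (e i) (e j) else 0.
have sumE (F : T -> int) : \sum_(k < #|T|) F (e k) = \sum_z F z.
  by rewrite -big_enum_val.
have MZ : M *m Z = 1%:M.
  apply/matrixP => i j; rewrite !mxE.
  under eq_bigr do rewrite /M /Z !mxE.
  rewrite (sumE (fun z =>
    (if (e i <= z)%O then moebius (e i) z else 0) * (z <= e j)%O%:R)).
  have [ij|nij] := boolP (e i <= e j)%O.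
    rewrite -(inj_eq enum_val_inj) -(moebius_sum ij) [RHS]big_mkcond /=.
    by apply: eq_bigr => z _; case: (_ <= _)%O; case: (_ <= _)%O;
      rewrite ?(mulr1, mulr0, mul0r).
  have -> : (i == j) = false by apply: contraNF nij => /eqP ->.
  rewrite big1 // => z _; case: ifP => [iz|]; last by rewrite mul0r.
  have -> : (z <= e j)%O = false by apply: contraNF nij; apply: le_trans.
  by rewrite mulr0.
have /matrixP/(_ (enum_rank x) (enum_rank y)) := mulmx1C MZ.
rewrite !mxE (inj_eq enum_rank_inj) => <-.
under [RHS]eq_bigr do rewrite /M /Z !mxE /e !enum_rankK -/(e _).
rewrite (sumE (fun z =>
  (x <= z)%O%:R * (if (z <= y)%O then moebius z y else 0))).
rewrite big_mkcond; apply: eq_bigr => z _.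
by case: (_ <= _)%O; case: (_ <= _)%O; rewrite ?(mul1r, mulr0, mul0r).
Qed.

End MoebiusDual.

Lemma prod_plain_barred (R : pzSemiRingType) n (F : 'I_n.*2 -> R) :
  \prod_(k < n.*2) F k = \prod_(i < n) (F (plain i) * F (barred i)).
Proof.
elim: n F => [|n IH] F; first by rewrite !big_ord0.
rewrite [LHS]big_ord_recr [in LHS]big_ord_recr /= IH big_ord_recr /= -mulrA.
congr (_ * (_ * _)); [|by congr F; apply: val_inj..].
by apply: eq_bigr => i _; congr (F _ * F _); apply: val_inj.
Qed.

Section Cumulants.
Variables (K : fieldType) (G : sgraph) (A : G -> ncps K).

Local Notation AG := (graph_alg A).
Local Notation DG := (diag_alg K G).

Definition block_cumulant n (x : 'I_n -> AG) (V : {set 'I_n}) : DG :=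
  cumulant (fun j : 'I_#|V| => x (enum_val j)).

(** Comparing the lists of arguments avoids casts between ordinal types that are only provably
    equal. *)
Lemma eq_cumulant n m (x : 'I_n -> AG) (y : 'I_m -> AG) :
  codom x = codom y -> cumulant x = cumulant y.
Proof.
move=> e; have em : n = m.
  by have := congr1 size e; rewrite !size_codom !card_ord.
subst m; congr cumulant; apply/funext => i.
move: e; rewrite !codomE => /eq_in_map; apply.
by rewrite mem_enum.
Qed.

Lemma codom_enum_val (aT : finType) rT (V : {set aT}) (f : aT -> rT) :
  codom (fun j : 'I_#|V| => f (enum_val j)) = map f (enum V).
Proof.
rewrite codomE (map_comp f enum_val); congr map.
case: (pickP (mem V)) => [x0 _|V0]; last first.
  have -> : enum V = [::] by apply: size0nil; rewrite -cardE; apply: eq_card0.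
  by apply: size0nil; rewrite size_map size_enum_ord; apply: eq_card0.
apply: (@eq_from_nth _ x0); first by rewrite size_map size_enum_ord cardE.
move=> i; rewrite size_map size_enum_ord => iV.
rewrite (nth_map (Ordinal iV)) ?size_enum_ord // (enum_val_nth x0).
by rewrite nth_enum_ord.
Qed.

Lemma block_cumulant_setT n (x : 'I_n -> AG) :
  block_cumulant x setT = cumulant x.
Proof.
by apply: eq_cumulant; rewrite codom_enum_val codomE enum_setT -enumT.
Qed.

Lemma block_cumulant_imset m n (f : 'I_m -> 'I_n) (x : 'I_n -> AG)
    (V : {set 'I_m}) : (forall i j, (f i < f j)%N = (i < j)%N) ->
  block_cumulant x (f @: V) = block_cumulant (x \o f) V.
Proof.
move=> f_lt; apply: eq_cumulant; rewrite !codom_enum_val enum_imset //.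
by rewrite -map_comp.
Qed.

Definition moment n (x : 'I_n -> AG) (V : {set 'I_n}) : DG :=
  graph_exp (\prod_(i in V) x i).

Lemma prod_enum_val (R : pzSemiRingType) n (x : 'I_n -> R) (V : {set 'I_n}) :
  \prod_(i in V) x i = \prod_(j < #|V|) x (enum_val j).
Proof.
have ie T : index_enum T = enum T by rewrite /index_enum enumT; unlock.
rewrite -big_filter !ie.
have -> : [seq i <- enum 'I_n | i \in V] = enum V by rewrite enumT.
by rewrite -(big_map x xpredT id) -codom_enum_val codomE big_map.
Qed.

Lemma enum_val_lt n (V : {set 'I_n}) (i j : 'I_#|V|) :
  ((enum_val i : 'I_n) < enum_val j)%N = (i < j)%N.
Proof.
have lt (k l : 'I_#|V|) : (k < l)%N -> ((enum_val k : 'I_n) < enum_val l)%N.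
  move=> kl; have x0 := enum_val k; rewrite !(enum_val_nth x0).
  apply: (sorted_ltn_nth _ _ (sorted_enum_ord V)) => //;
    rewrite ?inE -?cardE //.
  by move=> a b c; apply: ltn_trans.
case: (ltngtP i j) => [/lt//|/lt|/val_inj ->]; last exact: ltnn.
by move=> /ltnW; rewrite leqNgt => /negbTE.
Qed.

Definition moment_cumulant_for n (x : 'I_n -> AG) :=
  graph_exp (\prod_i x i) =
  \sum_(P in ncpart [set: 'I_n]) \prod_(V in P) block_cumulant x V.

Lemma moment_cumulant_set n (x : 'I_n -> AG) (S : {set 'I_n}) :
  moment_cumulant_for (fun j : 'I_#|S| => x (enum_val j)) ->
  moment x S = \sum_(P in ncpart S) \prod_(V in P) block_cumulant x V.
Proof.
rewrite /moment_cumulant_for -prod_enum_val -/(moment x S) => ->.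
have eS : (@enum_val _ (mem S)) @: [set: 'I_#|S|] = S.
  apply/setP => i; apply/imsetP/idP => [[j _ ->]|iS]; first exact: enum_valP.
  by exists (enum_rank_in iS i); rewrite ?enum_rankK_in.
have mono := @enum_val_lt _ S.
have := sum_push mono [set: 'I_#|S|]
  (fun P => \prod_(V in P) block_cumulant x V).
rewrite eS => ->; apply: eq_bigr => P _.
by rewrite (prod_push mono); apply: eq_bigr => V _;
  rewrite (block_cumulant_imset _ _ mono).
Qed.

(** Strong induction: a partition other than 1 has only blocks smaller than n, so its product of
    moments expands by induction into a sum over the finer partitions. Moebius inversion then
    extracts the top term. *)
Lemma moment_cumulant n (x : 'I_n -> AG) : (0 < n)%N -> moment_cumulant_for x.
Proof.
elim/ltn_ind: n x => n IH x n0.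
pose one : {set {set 'I_n}} := [set setT].
have T0 : [set: 'I_n] != set0.
  by apply/set0Pn; exists (Ordinal n0).
have v1 : val (nc_one n) = one.
  rewrite /=; apply/setP => B; rewrite !inE.
  have [->|_] := eqVneq B setT; last by rewrite andbF.
  by rewrite andbT; apply: T0.
have oneN : one \in ncpart setT := set1_ncpart T0.
have refines_one P : P \in ncpart setT -> refines P one.
  move=> PN; apply/forall_inP => B _; apply/exists_inP; exists setT.
    by rewrite inE.
  exact: subsetT.
pose k (P : {set {set 'I_n}}) := \prod_(V in P) block_cumulant x V.
(* At the one-block partition, [f] is defined so that the formula holds there; it remains to see
   that this value is the cumulant, which is [c1]. *)
pose f P : DG := if P == one then
  graph_exp (\prod_i x i) - \sum_(Q in ncpart setT | Q != one) k Q else k P.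
have mE P : P \in ncpart setT -> \prod_(V in P) moment x V =
    \sum_(Q in ncpart setT | refines Q P) f Q.
  move=> PN; have pP := ncpart_partition PN.
  have [->|nP] := eqVneq P one.
    rewrite big_set1 /moment (eq_bigl xpredT) => [|i]; last by rewrite inE.
    rewrite (eq_bigl (mem (ncpart setT))) => [|Q]; last first.
      by apply/andP/idP => [[]//|QN]; rewrite refines_one.
    rewrite (bigD1 one) //= {1}/f eqxx [X in _ + X](eq_bigr k) => [|Q].
      by rewrite subrK.
    by rewrite /f => /andP[_ /negbTE ->].
  have lt V : V \in P -> (0 < #|V| < n)%N.
    move=> VP; have [i iV] := partition_block_mem pP VP.
    rewrite card_gt0; apply/andP; split; first by apply/set0Pn; exists i.
    rewrite -[X in (_ < X)%N]card_ord -cardsT; apply: proper_card.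
    exact: partition_block_proper pP nP VP.
  transitivity (\prod_(V in P) \sum_(Q in ncpart V) k Q).
    apply: eq_bigr => V VP; apply: moment_cumulant_set.
    by have /andP[V0 Vn] := lt V VP; apply: IH.
  rewrite (prod_sum_ncpart (fun V Q => k Q) PN).
  apply: eq_bigr => Q /andP[QN QP].
  rewrite (prod_restr QN PN QP) /f ifN //; apply/eqP => Q1.
  have /exists_inP[V VP] : [exists V in P, setT \subset V].
    by apply: (forall_inP QP); rewrite Q1 inE.
  rewrite subTset => /eqP VT.
  by have := lt V VP; rewrite VT cardsT card_ord ltnn andbF.
have c1 : cumulant x = f one.
  rewrite /cumulant.
  transitivity (\sum_(P : NC n) \sum_(Q : NC n | (Q <= P)%O)
      f (val Q) * (moebius P (nc_one n))%:~R).
    apply: eq_bigr => P _; rewrite -big_distrl; congr (_ * _).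
    have PN : val P \in ncpart setT by rewrite inE (valP P).
    rewrite (mE _ PN) big_mkcondr -sum_NC [RHS]big_mkcond.
    by apply: eq_bigr.
  rewrite (exchange_big_dep xpredT) //= -v1.
  have Qle (Q : NC n) : (Q <= nc_one n)%O.
    by have := refines_one (val Q); rewrite inE (valP Q) -v1; apply.
  (* The sum of mu(P, 1) over Q <= P <= 1 is 1 if Q = 1 and 0 otherwise. *)
  have inner (Q : NC n) : \sum_(P | (Q <= P)%O)
      f (val Q) * (moebius P (nc_one n))%:~R = f (val Q) * (Q == nc_one n)%:R.
    rewrite -big_distrr -mulrz_sumr; congr (_ * _).
    rewrite -[RHS]mulrz_nat -(moebius_sum_dual (Qle Q)); congr (_ *~ _).
    by apply: eq_bigl => P; rewrite Qle andbT.
  rewrite (bigD1 (nc_one n)) //= inner eqxx mulr1 big1 ?addr0 // => Q nQ.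
  by rewrite inner (negbTE nQ) mulr0.
rewrite /moment_cumulant_for (bigD1 one) //= big_set1.
rewrite block_cumulant_setT c1 /f eqxx.
by rewrite addrC subrKC.
Qed.

Lemma moment_cumulantE n (x : 'I_n -> AG) (S : {set 'I_n}) : S != set0 ->
  moment x S = \sum_(P in ncpart S) \prod_(V in P) block_cumulant x V.
Proof.
by move=> S0; apply/moment_cumulant_set/moment_cumulant; rewrite card_gt0.
Qed.

End Cumulants.

(** * Cumulants of products *)

Section Products.
Variables (K : fieldType) (G : sgraph) (A : G -> ncps K).
Local Notation AG := (graph_alg A).
Variables (A1 A2 : set AG) (n : nat) (x y : 'I_n -> AG).
Hypotheses (freeA : Gfree_subalg A1 A2).
Hypotheses (xA : forall i, A1 (x i)) (yA : forall i, A2 (y i)).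

(** The default 0 is never reached, since k./2 < n. *)
Definition alternate (k : 'I_n.*2) : AG :=
  if insub k./2 is Some i then if odd k then y i else x i else 0.

Lemma alternate_plain i : alternate (plain i) = x i.
Proof.
by rewrite /alternate /= doubleK (valK i) odd_double.
Qed.

Lemma alternate_barred i : alternate (barred i) = y i.
Proof.
by rewrite /alternate /= uphalf_double (valK i) odd_double.
Qed.

Lemma block_cumulant_mixed B :
  ~~ monochrome B -> block_cumulant alternate B = 0.
Proof.
rewrite negb_or => /andP[/subsetPn[k kB nk] /subsetPn[l lB nl]].
have [[k' ek]|[k' ek]] := plain_or_barred k; first by rewrite ek codom_f in nk.
have [[l' el]|[l' el]] := plain_or_barred l; last by rewrite el codom_f in nl.
(* [true] marks the plain positions, whose entries lie in [A1]; the barred k and the plain l witness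
   that the colouring is not constant. *)
pose c (j : 'I_#|B|) := ~~ odd (enum_val j : 'I_n.*2).
have ck : c (enum_rank_in kB k) = false.
  by rewrite /c enum_rankK_in // ek /= odd_double.
have cl : c (enum_rank_in lB l) = true.
  by rewrite /c enum_rankK_in // el /= odd_double.
apply: (freeA (i := c)).
- apply: leq_trans (subset_leq_card (_ : [set k; l] \subset B)).
    by rewrite cards2 ek el; case: eqP => // /esym/plain_neq_barred.
  by apply/subsetP => m; rewrite !inE => /orP[] /eqP ->.
- move=> j; rewrite /c; have [[i ->]|[i ->]] := plain_or_barred (enum_val j).
    by rewrite /= odd_double alternate_plain.
  by rewrite /= odd_double alternate_barred.
- by exists (enum_rank_in kB k), (enum_rank_in lB l); rewrite ck cl.
Qed.

(** The coefficient in the claim for the subword indexed by [S]; all subsets are required since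
    cumulants are identified by recursion over blocks. *)
Definition boxed (S : {set 'I_n}) : diag_alg K G :=
  \sum_(P in ncpart S)
    (\prod_(B in P) block_cumulant x B) *
    (\prod_(B in krS S P) block_cumulant y B).

Local Notation z := (fun i => x i * y i).

Lemma moment_alternate (S : {set 'I_n}) :
  moment z S = moment alternate (plain_barred S).
Proof.
(* Both products are padded with factors 1 to all indices, so that they match position by
   position. *)
congr graph_exp; rewrite big_mkcond [RHS]big_mkcond prod_plain_barred.
apply: eq_bigr => i _.
rewrite plain_in barred_in alternate_plain alternate_barred.
by case: ifP; rewrite ?mulr1.
Qed.

Lemma moment_mul (S : {set 'I_n}) : S != set0 ->
  moment z S = \sum_(T in ncpart S) \prod_(V in T) boxed V.
Proof.
move=> /set0Pn[s sS]; rewrite moment_alternate moment_cumulantE; last first.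
  by apply/set0Pn; exists (plain s); rewrite plain_in.
(* Partitions with a two-coloured block contribute 0 by freeness; the others are interleavings. *)
rewrite (bigID (fun R : {set {set 'I_n.*2}} =>
  [forall B in R, monochrome B])) /=.
rewrite [X in _ + X]big1 ?addr0 => [|R /andP[_]]; last first.
  rewrite negb_forall_in => /exists_inP[B BR nB].
  by rewrite (bigD1 B) //= block_cumulant_mixed // mul0r.
rewrite sum_interleave -sum_boxed.
apply: eq_bigr => P PN; apply: eq_bigr => Q /andP[QN _].
rewrite (prod_interleave _ (ncpart_partition PN) (ncpart_partition QN)).
congr (_ * _); apply: eq_bigr => B _; rewrite block_cumulant_imset.
- by congr cumulant; apply/funext => j; rewrite /= alternate_plain.
- by move=> i j; rewrite /= ltn_double.
- by congr cumulant; apply/funext => j; rewrite /= alternate_barred.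
- by move=> i j; rewrite /= ltnS ltn_double.
Qed.

(** Both families satisfy the same moment-cumulant formula. Its one-block term is the value at [S],
    and its other terms involve proper subsets only, so induction on the cardinality applies. *)
Lemma block_cumulant_mul (S : {set 'I_n}) :
  S != set0 -> block_cumulant z S = boxed S.
Proof.
move: {2}#|S| (erefl #|S|) => c; elim/ltn_ind: c S => c IH S Sc S0.
have := moment_mul S0; rewrite (moment_cumulantE _ S0).
have SN := set1_ncpart S0.
(* The sums over the remaining partitions agree by induction and are cancelled. *)
rewrite (bigD1 [set S]) // [RHS](bigD1 [set S]) //= !big_set1.
set a := \sum_(P in _ | _) _; set b := \sum_(P in _ | _) _.
suff -> : a = b by apply: addIr.
apply: eq_bigr => T /andP[TN nT]; apply: eq_bigr => V VT.
have pT := ncpart_partition TN.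
apply: (IH #|V|) => //.
  by rewrite -Sc; apply: proper_card (partition_block_proper pT nT VT).
by apply/set0Pn; apply: partition_block_mem pT VT.
Qed.

Lemma cumulant_mul : (0 < n)%N -> cumulant z =
  \sum_(P : NC n) cumulant_pi P x * cumulant_pi (Kr P) y.
Proof.
move=> n0; rewrite -block_cumulant_setT block_cumulant_mul /boxed; last first.
  by apply/set0Pn; exists (Ordinal n0); rewrite inE.
rewrite -(sum_NC (fun P => (\prod_(B in P) block_cumulant x B) *
  \prod_(B in krS setT P) block_cumulant y B)).
by apply: eq_bigr => P _; rewrite -val_Kr.
Qed.

End Products.

Theorem proposition2p3 (R : realType) (G : sgraph) (A : G -> ncps R[i])
    (s : nat) (x y : 'I_s -> graph_alg A)
    (hfree : Gfree (range x)%classic (range y)%classic) :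
  Rtransform (fun i => x i * y i) = boxed_conv x y
  /\
  forall j : 'I_s,
    Rtransform (fun _ : 'I_1 => x j * y j) =
      boxed_conv (fun _ : 'I_1 => x j) (fun _ : 'I_1 => y j) /\
    boxed_conv (fun _ : 'I_1 => x j) (fun _ : 'I_1 => y j) =
      ncseries_of (fun n (_ : 'I_n -> 'I_1) => \sum_(P : NC n)
        cumulant_pi P (fun _ => x j) * cumulant_pi (Kr P) (fun _ => y j)).
Proof.
have mem_gen (X : set (graph_alg A)) (u : 'I_s -> graph_alg A) i :
    (range u `<=` X)%classic -> subalg_gen X (u i).
  by move=> uX; apply: sub_gen_smallest; apply: uX; exists i.
have xA i := mem_gen _ x i
  (@classical_sets.subsetUl _ (range x) (range (@diag_in _ G A))).
have yA i := mem_gen _ y i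
  (@classical_sets.subsetUl _ (range y) (range (@diag_in _ G A))).
(* The coefficients at the empty word are 0 by definition; a nonempty word has the positive length
   that [cumulant_mul] asks for. The one-variable case applies it to constant families. *)
split=> [|j]; last split=> //; apply/funext => -[|w0 w] //.
  exact: (cumulant_mul hfree (fun k => xA _) (fun k => yA _)).
exact: (cumulant_mul hfree (fun k => xA _) (fun k => yA _)).
Qed.
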